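(* Assume $r_k\ge4/7$ for all $k\ge2$, $\kappa\ge\|f'\|_{C[-\beta,\beta]}$, $\|\phi^0\|_\infty\le\beta$, and $$\tau_1\le\min\Big\{\Big(\frac{4}{11\varsigma m(\kappa+4\varepsilon^2/h^2)\Gamma(2-\alpha)}\Big)^{1/\alpha},\Big(\frac{4}{11\kappa(1-\varsigma)m\Gamma(2-\alpha)}\Big)^{1/\alpha}\Big\}.$$ Then the (balanced) $L2$-$1_\sigma$-sESAV scheme is energy-stable without further time-step size restriction: $\mathcal E_h[\phi^n,R^n]\le\mathcal E_h[\phi^0,R^0]$ for all $n\ge1$.
   Context: Setting: $\Omega=(0,L)^2$ with periodic boundary conditions; constants $m>0$, $\varepsilon>0$, $\alpha\in(0,1)$, and $\varsigma:=\alpha/2$. The nonlinearity $f=-F'$ is one of: (double-well) $F(\phi)=\frac14(1-\phi^2)^2$, $f(\phi)=\phi-\phi^3$, with $\beta=1$; or (Flory–Huggins) $F(\phi)=\frac{\theta}{2}[(1+\phi)\ln(1+\phi)+(1-\phi)\ln(1-\phi)]-\frac{\theta_c}{2}\phi^2$, $f(\phi)=\frac{\theta}{2}\ln\frac{1-\phi}{1+\phi}+\theta_c\phi$ on $(-1,1)$, with $\theta_c>\theta>0$ and $\beta\in(0,1)$ the positive root of $f$. In both cases $f(\pm\beta)=0$. Spatial discretization: $M\in\mathbb N$, $h=L/M$; $\mathbb V_h$ is the space of real grid functions $v=\{v_{ij}\}_{i,j\in\mathbb Z}$ that are $M$-periodic in each index; $\langle v,w\rangle=h^2\sum_{i,j=1}^Mv_{ij}w_{ij}$,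 $\|v\|=\sqrt{\langle v,v\rangle}$, $\|v\|_\infty=\max_{1\le i,j\le M}|v_{ij}|$; $\Delta_hv_{ij}=h^{-2}(v_{i+1,j}+v_{i-1,j}+v_{i,j+1}+v_{i,j-1}-4v_{ij})$; $\nabla_hv_{ij}=\big(\frac{v_{i+1,j}-v_{ij}}h,\frac{v_{i,j+1}-v_{ij}}h\big)$ and $\|\nabla_hv\|^2=h^2\sum_{i,j=1}^M|\nabla_hv_{ij}|^2$. Scalar functions act on grid functions pointwise. $E_{1h}[v]=\langle F(v),1\rangle$ and $g_h(v,w)=\exp(w)/\exp(E_{1h}[v])$ for $v\in\mathbb V_h$ (with $\|v\|_\infty<1$ in the Flory–Huggins case) and $w\in\mathbb R$. The discrete modified energy is $\mathcal E_h[\phi,R]=\frac{\varepsilon^2}{2}\|\nabla_h\phi\|^2+R$. Auxiliary functional: $V:\mathbb R\to\mathbb R$ satisfies (A1) $V\in C^1(\mathbb R)\cap W^{2,\infty}(\mathbb R)$, $V(1)=1$, $V'(1)=0$, $|V'|\le K_1$; (A2) $0\le V\le K_2$ for a constant $K_2>0$; (A3) $|z_1-1|\le|z_2-1|$ implies $|V(z_1)-1|\le|V(z_2)-1|$. Time grid: $0=t_0<t_1<\dots<t_N=T$, $\tau_k=t_k-t_{k-1}$, $r_k=\tau_k/\tau_{k-1}$ ($k\ge2$), $\nabla_\tau v^k=v^k-v^{k-1}$, $\mathbb D_\tau v^k=\nabla_\tau v^k/\tau_k$, $\omega_\mu(t)=t^{\mu-1}/\Gamma(\mu)$. Constant $\kappa\ge0$;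 data $\phi^0\in\mathbb V_h$, $R^0\in\mathbb R$. For $n\ge2$ the predicted solution is $\hat\phi^n=\min\{\max\{(1+r_n)\phi^{n-1}-r_n\phi^{n-2},-\beta\},\beta\}$ (pointwise). $L2$-$1_\sigma$ discretization: $t_{k-\varsigma}=(1-\varsigma)t_k+\varsigma t_{k-1}$, $t_{k-1/2}=(t_k+t_{k-1})/2$; $a^{(n)}_{n-k}=\frac1{\tau_k}\int_{t_{k-1}}^{\min\{t_k,t_{n-\varsigma}\}}\omega_{1-\alpha}(t_{n-\varsigma}-s)\,ds$ ($1\le k\le n$), $b^{(n)}_{n-k}=\frac{2}{\tau_k(\tau_k+\tau_{k+1})}\int_{t_{k-1}}^{t_k}(s-t_{k-1/2})\omega_{1-\alpha}(t_{n-\varsigma}-s)\,ds$ ($1\le k\le n-1$); $B^{(1)}_0=a^{(1)}_0$, and for $n\ge2$: $B^{(n)}_0=a^{(n)}_0+b^{(n)}_1/r_n$, $B^{(n)}_{n-k}=a^{(n)}_{n-k}+b^{(n)}_{n-k+1}/r_k-b^{(n)}_{n-k}$ for $2\le k\le n-1$, $B^{(n)}_{n-1}=a^{(n)}_{n-1}-b^{(n)}_{n-1}$; $\tilde{\mathbb D}^\alpha_\tau v^n=\sum_{k=1}^nB^{(n)}_{n-k}\nabla_\tau v^k$; $w^{k-\varsigma}=(1-\varsigma)w^k+\varsigma w^{k-1}$. Balanced $L2$-$1_\sigma$-sESAV scheme: $\hat\phi^1\in\mathbb V_h$ with $\|\hat\phi^1\|_\infty\le\beta$ solves $B^{(1)}_0(\hat\phi^1-\phi^0)=m(\varepsilon^2\Delta_h\hat\phi^{1-\varsigma}+f(\hat\phi^{1-\varsigma}))$;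 for $n\ge2$, $\hat\phi^n$ is the predicted solution above. For $n\ge1$ set $\hat\phi^{n-\varsigma}=(1-\varsigma)\hat\phi^n+\varsigma\phi^{n-1}$ and $V^{n-\varsigma}=V(g_h(\hat\phi^{n-\varsigma},R^{n-1}))$, and define $(\phi^n,R^n)$ by $\tilde{\mathbb D}^\alpha_\tau\phi^n=m(\varepsilon^2\Delta_h\phi^{n-\varsigma}+V^{n-\varsigma}f(\hat\phi^{n-\varsigma})-\kappa V^{n-\varsigma}(\phi^{n-\varsigma}-\hat\phi^{n-\varsigma}))$ and $\mathbb D_\tau R^n=V^{n-\varsigma}\langle-f(\hat\phi^{n-\varsigma})+\kappa(\phi^{n-\varsigma}-\hat\phi^{n-\varsigma}),\mathbb D_\tau\phi^n\rangle$. *)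

(* Defs.v *)
From HB Require Import structures.
From mathcomp Require Import all_boot all_order all_algebra.
From mathcomp Require Import all_classical all_reals all_analysis.
Set Implicit Arguments. Unset Strict Implicit. Unset Printing Implicit Defensive.
Import Order.TTheory GRing.Theory Num.Theory.
Import numFieldNormedType.Exports.
Local Open Scope classical_set_scope.
Local Open Scope ring_scope.

Definition Gamma {R : realType} (x : R) : R :=
  \int[lebesgue_measure]_(u in `]0, +oo[) (u `^ (x - 1) * expR (- u)).

Definition omega {R : realType} (mu t : R) : R := t `^ (mu - 1) / Gamma mu.

Definition F_dw {R : realType} (x : R) : R := (1 - x ^+ 2) ^+ 2 / 4.
Definition f_dw {R : realType} (x : R) : R := x - x ^+ 3.
Definition F_fh {R : realType} (th thc x : R) : R :=
  th / 2 * ((1 + x) * ln (1 + x) + (1 - x) * ln (1 - x)) - thc / 2 * x ^+ 2.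
Definition f_fh {R : realType} (th thc x : R) : R :=
  th / 2 * ln ((1 - x) / (1 + x)) + thc * x.

Definition admissible_potential {R : realType} (F f : R -> R) (beta : R) : Prop :=
  (F = F_dw /\ f = f_dw /\ beta = 1) \/
  (exists th thc : R, 0 < th < thc /\ F = F_fh th thc /\ f = f_fh th thc /\
     0 < beta < 1 /\ f beta = 0).

Definition V_assumptions {R : realType} (V : R -> R) (K1 K2 : R) : Prop :=
  (* (A1): V in C^1 /\ W^{2,oo}: V, V' bounded and V' Lipschitz *)
  (forall x, derivable V x 1) /\ continuous (derive1 V) /\
  (exists C, forall x, `|V x| <= C) /\ (exists C, forall x, `|derive1 V x| <= C) /\
  (exists Lip, forall x y, `|derive1 V x - derive1 V y| <= Lip * `|x - y|) /\
  V 1 = 1 /\ derive1 V 1 = 0 /\ (forall x, `|derive1 V x| <= K1) /\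
  0 < K2 /\ (forall x, 0 <= V x <= K2) /\
  (forall z1 z2, `|z1 - 1| <= `|z2 - 1| -> `|V z1 - 1| <= `|V z2 - 1|).

(* ---------- spatial discretization: M-periodic grid functions ---------- *)
Definition grid (R : realType) (M : nat) := 'I_M -> 'I_M -> R.

Definition inner {R : realType} {M : nat} (h : R) (v w : grid R M) : R :=
  h ^+ 2 * \sum_(i < M) \sum_(j < M) v i j * w i j.

Definition supnorm {R : realType} {M : nat} (v : grid R M) : R :=
  \big[Num.max/0]_(i < M) \big[Num.max/0]_(j < M) `|v i j|.

Definition lap {R : realType} {M : nat} (h : R) (v : grid R M) : grid R M :=
  fun i j => (v (ordS i) j + v (ord_pred i) j + v i (ordS j) + v i (ord_pred j)
              - 4 * v i j) / h ^+ 2.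

Definition grad_sq {R : realType} {M : nat} (h : R) (v : grid R M) : R :=
  h ^+ 2 * \sum_(i < M) \sum_(j < M)
     (((v (ordS i) j - v i j) / h) ^+ 2 + ((v i (ordS j) - v i j) / h) ^+ 2).

Definition E1h {R : realType} {M : nat} (h : R) (F : R -> R) (v : grid R M) : R :=
  inner h (fun i j => F (v i j)) (fun _ _ => 1).

Definition gh {R : realType} {M : nat} (h : R) (F : R -> R) (v : grid R M) (w : R) : R :=
  expR w / expR (E1h h F v).

Definition energy {R : realType} {M : nat} (h eps : R) (v : grid R M) (Rv : R) : R :=
  eps ^+ 2 / 2 * grad_sq h v + Rv.

Definition step {R : realType} (t : nat -> R) (k : nat) : R := t k - t k.-1.
Definition step_ratio {R : realType} (t : nat -> R) (k : nat) : R := step t k / step t k.-1.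
Definition tshift {R : realType} (t : nat -> R) (s : R) (k : nat) : R :=
  (1 - s) * t k + s * t k.-1.
Definition thalf {R : realType} (t : nat -> R) (k : nat) : R := (t k + t k.-1) / 2.

(* a^{(n)}_{n-k}, with varsigma = alpha/2 *)
Definition acoef {R : realType} (alpha : R) (t : nat -> R) (n k : nat) : R :=
  (step t k)^-1 *
  \int[lebesgue_measure]_(u in `[t k.-1, Num.min (t k) (tshift t (alpha / 2) n)])
     omega (1 - alpha) (tshift t (alpha / 2) n - u).

Definition bcoef {R : realType} (alpha : R) (t : nat -> R) (n k : nat) : R :=
  2 / (step t k * (step t k + step t k.+1)) *
  \int[lebesgue_measure]_(u in `[t k.-1, t k])
     ((u - thalf t k) * omega (1 - alpha) (tshift t (alpha / 2) n - u)).

Definition Bcoef {R : realType} (alpha : R) (t : nat -> R) (n k : nat) : R :=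
  if n == 1%N then acoef alpha t 1 1
  else if k == n then acoef alpha t n n + bcoef alpha t n n.-1 / step_ratio t n
  else if k == 1%N then acoef alpha t n 1 - bcoef alpha t n 1
  else acoef alpha t n k + bcoef alpha t n k.-1 / step_ratio t k - bcoef alpha t n k.

Definition Dfrac {R : realType} {M : nat} (alpha : R) (t : nat -> R)
  (v : nat -> grid R M) (n : nat) : grid R M :=
  fun i j => \sum_(1 <= k < n.+1) Bcoef alpha t n k * (v k i j - v k.-1 i j).

Definition gmix {R : realType} {M : nat} (s : R) (new old : grid R M) : grid R M :=
  fun i j => (1 - s) * new i j + s * old i j.

Definition clamp {R : realType} (beta x : R) : R := Num.min (Num.max x (- beta)) beta.

(* Main.v *)
Require Import Defs.
From HB Require Import structures.
From mathcomp Require Import all_boot all_order all_algebra.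
From mathcomp Require Import all_classical all_reals all_analysis.
From mathcomp Require Import measurable_realfun zify ring lra.
Import Order.TTheory GRing.Theory Num.Theory.
Import numFieldNormedType.Exports.
Local Open Scope classical_set_scope.
Local Open Scope ring_scope.

(** Testing the scheme with phi^n - phi^(n-1) gives
    E^n - E^(n-1) <= - (1/m) <D phi^n, phi^n - phi^(n-1)>, so stability reduces to
    the positive semidefiniteness of the quadratic form of the L2-1_sigma
    coefficients B(n, j).  Double the diagonal of B and set
    a(n, j) = B(n, j) - B(n, j-1), with B(n, 0) = 0.  By Abel summation the n-th row
    of the form is at least half the increment of sum_j a(n, j) (w_j + ... + w_n)^2
    if a(n+1, j) <= a(n, j); it then remains to have a >= 0.
    For j < n, a(n, j) is a fixed linear functional, independent of n, of the
    kernel u |-> (t_(n-sigma) - u)^(-alpha); it is nonnegative on every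
    nonnegative, nondecreasing convex kernel when the step ratios are at least 4/7.
    The difference of two consecutive kernels is again of this kind, which yields
    the monotonicity in n; the rows next to the diagonal use the explicit
    value of the singular integral. *)

(** * Averages and first moments over an interval *)

Definition continuous_on {R : realType} (a b : R) (f : R -> R) :=
  forall u, a <= u <= b -> {for u, continuous f}.

Lemma continuous_on_within {R : realType} (a b : R) (f : R -> R) :
  continuous_on a b f -> {within `[a, b], continuous f}.
Proof.
move=> cf; apply: continuous_in_subspaceT => u; rewrite inE/= in_itv/=.
exact: cf.
Qed.

Lemma continuous_on_integrable {R : realType} (a b : R) (f : R -> R) :
  continuous_on a b f -> lebesgue_measure.-integrable `[a, b] (EFin \o f).
Proof.
move=> cf; apply: continuous_compact_integrable; first exact: segment_compact.
exact: continuous_on_within.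
Qed.

Lemma continuous_onM {R : realType} (a b : R) (f g : R -> R) :
  continuous_on a b f -> continuous_on a b g -> continuous_on a b (fun u => f u * g u).
Proof. by move=> cf cg u ab; apply: cvgM; [exact: cf|exact: cg]. Qed.

Lemma continuous_onD {R : realType} (a b : R) (f g : R -> R) :
  continuous_on a b f -> continuous_on a b g -> continuous_on a b (fun u => f u + g u).
Proof. by move=> cf cg u ab; apply: cvgD; [exact: cf|exact: cg]. Qed.

Lemma continuous_on_cst {R : realType} (a b c : R) : continuous_on a b (fun=> c).
Proof. by move=> u ab; exact: cvg_cst. Qed.

Lemma continuous_on_id {R : realType} (a b : R) : continuous_on a b id.
Proof. by move=> u ab; exact: cvg_id. Qed.

Lemma continuous_on_aff {R : realType} (a b p q : R) : continuous_on a b (fun u => p + q * u).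
Proof.
apply: continuous_onD; first exact: continuous_on_cst.
by apply: continuous_onM; [exact: continuous_on_cst|exact: continuous_on_id].
Qed.

Lemma continuous_on_affM {R : realType} (a b p q : R) (f : R -> R) :
  continuous_on a b f -> continuous_on a b (fun u => (p + q * u) * f u).
Proof. by move=> cf; apply: continuous_onM => //; exact: continuous_on_aff. Qed.

(** Expanding the affine weight about the midpoint leaves only the plain integral and the centred
    first moment of [f]; this is why [avg] and [mom] suffice for all estimates below. *)
Lemma int_affM {R : realType} (a b p q : R) (f : R -> R) : continuous_on a b f ->
  \int[lebesgue_measure]_(u in `[a, b]) ((p + q * u) * f u) =
  (p + q * ((a + b) / 2)) * \int[lebesgue_measure]_(u in `[a, b]) f u
  + q * \int[lebesgue_measure]_(u in `[a, b]) ((u - (a + b) / 2) * f u).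
Proof.
move=> cf.
have cg : continuous_on a b (fun u => (u - (a + b) / 2) * f u).
  apply: continuous_onM => //; apply: continuous_onD; first exact: continuous_on_id.
  exact: continuous_on_cst.
have cc c g : continuous_on a b g -> continuous_on a b (fun u => c * g u).
  by move=> cg'; apply: continuous_onM => //; exact: continuous_on_cst.
rewrite -!RintegralZl//; try exact: continuous_on_integrable.
rewrite -RintegralD//; try by apply: continuous_on_integrable; exact: cc.
by apply: eq_Rintegral => u _ /=; ring.
Qed.

Lemma int_sub {R : realType} (a b : R) (f g : R -> R) :
  continuous_on a b f -> continuous_on a b g ->
  \int[lebesgue_measure]_(u in `[a, b]) (f u - g u) =
  \int[lebesgue_measure]_(u in `[a, b]) f u - \int[lebesgue_measure]_(u in `[a, b]) g u.
Proof.
by move=> cf cg; rewrite RintegralB//; exact: continuous_on_integrable.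
Qed.

Lemma int_le {R : realType} (a b : R) (f g : R -> R) :
  continuous_on a b f -> continuous_on a b g ->
  (forall u, a <= u <= b -> f u <= g u) ->
  \int[lebesgue_measure]_(u in `[a, b]) f u <= \int[lebesgue_measure]_(u in `[a, b]) g u.
Proof.
move=> cf cg fg; by apply: le_Rintegral => //; exact: continuous_on_integrable.
Qed.

Lemma int_cst {R : realType} (a b c : R) : a <= b ->
  \int[lebesgue_measure]_(u in `[a, b]) c = c * (b - a).
Proof.
move=> ab; rewrite Rintegral_cst//= lebesgue_measure_itv/= lte_fin.
by case: ltgtP ab => //= [->] _; rewrite subrr.
Qed.

Lemma int_FTC {R : realType} (a b : R) (f F : R -> R) : a < b ->
  continuous_on a b f -> (forall u, a <= u <= b -> is_derive u 1 F (f u)) ->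
  \int[lebesgue_measure]_(u in `[a, b]) f u = F b - F a.
Proof.
move=> ab cf dF; rewrite /Rintegral (@continuous_FTC2 _ f F)//.
- exact: continuous_on_within.
- have cF u : a <= u <= b -> {for u, continuous F}.
    move=> /dF[dFu _]; apply: differentiable_continuous.
    exact/derivable1_diffP.
  split.
  + move=> u; rewrite in_itv/= => /andP[au ub].
    by have [] := dF u; rewrite ?ltW.
  + by apply: cvg_at_right_filter; apply: cF; rewrite lexx ltW.
  + by apply: cvg_at_left_filter; apply: cF; rewrite lexx ltW.
- move=> u; rewrite in_itv/= => /andP[au ub]; rewrite derive1E.
  by have [|_ ->] := dF u; rewrite ?ltW.
Qed.

Lemma int_mid {R : realType} (a b : R) : a < b ->
  \int[lebesgue_measure]_(u in `[a, b]) (u - (a + b) / 2) = 0.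
Proof.
move=> ab; apply: (etrans (@int_FTC R a b (fun u => u - (a + b) / 2)
  (fun u => (u - (a + b) / 2) ^+ 2 / 2) ab _ _)).
- apply: continuous_onD; first exact: continuous_on_id.
  exact: continuous_on_cst.
- move=> u _; apply: is_derive_eq.
  by rewrite /GRing.scale/=; field.
- by field.
Qed.

Lemma int_mid_sq {R : realType} (a b : R) : a < b ->
  \int[lebesgue_measure]_(u in `[a, b]) ((u - (a + b) / 2) * u) = (b - a) ^+ 3 / 12.
Proof.
move=> ab; apply: (etrans (@int_FTC R a b (fun u => (u - (a + b) / 2) * u)
  (fun u => u ^+ 3 / 3 - (a + b) / 2 * u ^+ 2 / 2) ab _ _)).
- apply: continuous_onM; last exact: continuous_on_id.
  apply: continuous_onD; first exact: continuous_on_id.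
  exact: continuous_on_cst.
- move=> u _; apply: is_derive_eq.
  by rewrite /GRing.scale/=; field.
- by field.
Qed.

Definition avg {R : realType} (a b : R) (k : R -> R) : R :=
  (b - a)^-1 * \int[lebesgue_measure]_(u in `[a, b]) k u.

(* Scaled so that, like [avg], it is invariant under affine reparametrization of
   the interval. *)
Definition mom {R : realType} (a b : R) (k : R -> R) : R :=
  (b - a)^-2 * \int[lebesgue_measure]_(u in `[a, b]) ((u - (a + b) / 2) * k u).

Lemma continuous_on_aff1 {R : realType} (a b p q : R) :
  continuous_on a b (fun u => (p + q * u) * 1).
Proof. by apply: continuous_on_affM; exact: continuous_on_cst. Qed.

Lemma avgE {R : realType} (a b : R) (k : R -> R) : a < b ->
  \int[lebesgue_measure]_(u in `[a, b]) k u = (b - a) * avg a b k.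
Proof. by move=> ab; rewrite /avg mulVKf// gt_eqF// subr_gt0. Qed.

Lemma momE {R : realType} (a b : R) (k : R -> R) : a < b ->
  \int[lebesgue_measure]_(u in `[a, b]) ((u - (a + b) / 2) * k u) = (b - a) ^+ 2 * mom a b k.
Proof. by move=> ab; rewrite /mom mulVKf// expf_neq0// gt_eqF// subr_gt0. Qed.

Lemma continuous_on_mid {R : realType} (a b c : R) (k : R -> R) :
  continuous_on a b k -> continuous_on a b (fun u => (u - c) * k u).
Proof.
move=> ck; apply: continuous_onM => //; apply: continuous_onD; first exact: continuous_on_id.
exact: continuous_on_cst.
Qed.

Lemma avgB {R : realType} (a b : R) (k k' : R -> R) : continuous_on a b k -> continuous_on a b k' ->
  avg a b (fun u => k u - k' u) = avg a b k - avg a b k'.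
Proof. by move=> ck ck'; rewrite /avg int_sub// mulrBr. Qed.

Lemma momB {R : realType} (a b : R) (k k' : R -> R) : continuous_on a b k -> continuous_on a b k' ->
  mom a b (fun u => k u - k' u) = mom a b k - mom a b k'.
Proof.
move=> ck ck'; rewrite /mom -mulrBr -int_sub; [|exact: continuous_on_mid|exact: continuous_on_mid].
by congr (_ * _); apply: eq_Rintegral => u _; rewrite mulrBr.
Qed.

Lemma int_aff {R : realType} (a b p q : R) : a < b ->
  \int[lebesgue_measure]_(u in `[a, b]) ((p + q * u) * 1) = (p + q * ((a + b) / 2)) * (b - a).
Proof.
move=> ab; rewrite (@int_affM _ a b p q (fun=> 1)); last exact: continuous_on_cst.
rewrite int_cst ?ltW//; under eq_Rintegral do rewrite mulr1.
by rewrite int_mid//; ring.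
Qed.

(** Together with [aff_ge] this turns a pointwise bound with an affine weight into a linear
    inequality between [avg] and [mom]; each estimate below is a choice of [p], [q] and [k']. *)
Lemma aff_le {R : realType} (a b p q : R) (k k' : R -> R) : a < b ->
  continuous_on a b k -> continuous_on a b k' ->
  (forall u, a <= u <= b -> (p + q * u) * k u <= k' u) ->
  (p + q * ((a + b) / 2)) * (b - a) * avg a b k + q * (b - a) ^+ 2 * mom a b k
  <= \int[lebesgue_measure]_(u in `[a, b]) k' u.
Proof.
move=> ab ck ck' H.
have /(_ (continuous_on_affM _ _ _ _ _ ck) ck' H) :=
  @int_le R a b (fun u => (p + q * u) * k u) k'.
by rewrite (@int_affM _ a b p q k)// (@avgE _ a b k)// (@momE _ a b k)// !mulrA.
Qed.

Lemma aff_ge {R : realType} (a b p q : R) (k k' : R -> R) : a < b ->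
  continuous_on a b k -> continuous_on a b k' ->
  (forall u, a <= u <= b -> k' u <= (p + q * u) * k u) ->
  \int[lebesgue_measure]_(u in `[a, b]) k' u <=
  (p + q * ((a + b) / 2)) * (b - a) * avg a b k + q * (b - a) ^+ 2 * mom a b k.
Proof.
move=> ab ck ck' H.
have /(_ ck' (continuous_on_affM _ _ _ _ _ ck) H) :=
  @int_le R a b k' (fun u => (p + q * u) * k u).
by rewrite (@int_affM _ a b p q k)// (@avgE _ a b k)// (@momE _ a b k)// !mulrA.
Qed.

(** The weight 2(b - u) is nonnegative with integral (b - a)^2, and against it [k] integrates to (b
    - a)^2 (avg - 2 mom). *)
Lemma avg_mom_ge {R : realType} (a b : R) (k : R -> R) : a < b ->
  continuous_on a b k ->
  (forall u, a <= u <= b -> k a <= k u) -> k a + 2 * mom a b k <= avg a b k.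
Proof.
move=> ab ck kn; have ba0 : 0 < b - a by rewrite subr_gt0.
have := @aff_ge R a b (2 * b) (-2) k
  (fun u => (2 * b * k a + (- 2 * k a) * u) * 1)
  ab ck (continuous_on_aff1 _ _ _ _).
have H u : a <= u <= b ->
    (2 * b * k a + (- 2 * k a) * u) * 1 <= (2 * b + -2 * u) * k u.
  move=> /[dup]/kn ? /andP[? ?]; nra.
move=> /(_ H); rewrite int_aff//.
have -> : (2 * b * k a + -2 * k a * ((a + b) / 2)) * (b - a) = (b - a) ^+ 2 * k a by field.
have -> : (2 * b + -2 * ((a + b) / 2)) * (b - a) * avg a b k + -2 * (b - a) ^+ 2 * mom a b k
  = (b - a) ^+ 2 * (avg a b k - 2 * mom a b k) by field.
by rewrite ler_pM2l ?exprn_gt0//; lra.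
Qed.

(** The mirror image, with the weight 2(u - a). *)
Lemma avg_mom_le {R : realType} (a b : R) (k : R -> R) : a < b ->
  continuous_on a b k ->
  (forall u, a <= u <= b -> k u <= k b) -> avg a b k + 2 * mom a b k <= k b.
Proof.
move=> ab ck kn; have ba0 : 0 < b - a by rewrite subr_gt0.
have := @aff_le R a b (- 2 * a) 2 k
  (fun u => (- 2 * a * k b + (2 * k b) * u) * 1)
  ab ck (continuous_on_aff1 _ _ _ _).
have H u : a <= u <= b ->
    (- 2 * a + 2 * u) * k u <= (- 2 * a * k b + (2 * k b) * u) * 1.
  move=> /[dup]/kn ? /andP[? ?]; nra.
move=> /(_ H); rewrite int_aff//.
have -> : (- 2 * a * k b + 2 * k b * ((a + b) / 2)) * (b - a) = (b - a) ^+ 2 * k b by field.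
have -> : (- 2 * a + 2 * ((a + b) / 2)) * (b - a) * avg a b k + 2 * (b - a) ^+ 2 * mom a b k
  = (b - a) ^+ 2 * (avg a b k + 2 * mom a b k) by field.
by rewrite ler_pM2l ?exprn_gt0.
Qed.

(** Around the midpoint c, u - c and k u - k c - q (u - c) have the same sign, so their product is
    nonnegative. The constant 1/12 comes from the integral (b - a)^3 / 12 of (u - c)^2. *)
Lemma mom_slope_ge {R : realType} (a b q : R) (k : R -> R) : a < b ->
  continuous_on a b k ->
  (forall u v, a <= u -> u <= v -> v <= b -> q * (v - u) <= k v - k u) ->
  q * (b - a) / 12 <= mom a b k.
Proof.
move=> ab ck kn; have ba0 : 0 < b - a by rewrite subr_gt0.
have [c cE] : exists c, c = (a + b) / 2 by exists ((a + b) / 2).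
have [ac cb] : a <= c /\ c <= b by split; lra.
(* The comparison function is (u - c)(k c + q (u - c)), split into an affine part and a multiple of
   (u - c) u. *)
have := @aff_ge R a b (- c) 1 k
   (fun u => ((- c) * (k c - q * c) + (k c - q * c) * u) * 1 + q * ((u - c) * u)) ab ck.
have cc : continuous_on a b
   (fun u => ((- c) * (k c - q * c) + (k c - q * c) * u) * 1 + q * ((u - c) * u)).
  apply: continuous_onD; first exact: continuous_on_aff1.
  apply: continuous_onM; first exact: continuous_on_cst.
  by rewrite cE; exact/continuous_on_mid/continuous_on_id.
have H u : a <= u <= b ->
   ((- c) * (k c - q * c) + (k c - q * c) * u) * 1 + q * ((u - c) * u)
   <= (- c + 1 * u) * k u.
  move=> /andP[au ub].
  have [uc|/ltW cu] := leP u c.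
    have := @kn u c au uc; nra.
  have := @kn c u ac cu ub; nra.
move=> /(_ cc H); rewrite cE RintegralD//; last 2 first.
- exact/continuous_on_integrable/continuous_on_aff1.
- apply: continuous_on_integrable; apply: continuous_onM; first exact: continuous_on_cst.
  exact/continuous_on_mid/continuous_on_id.
rewrite int_aff// RintegralZl//; last first.
  exact/continuous_on_integrable/continuous_on_mid/continuous_on_id.
rewrite int_mid_sq// -cE mul1r addNr !mul0r add0r mul1r.
rewrite (_ : - c * (k c - q * c) + (k c - q * c) * c = 0) ?mul0r ?add0r; last by ring.
rewrite (_ : q * _ = (b - a) ^+ 2 * (q * (b - a) / 12)); last by field.
by rewrite ler_pM2l// exprn_gt0.
Qed.

Lemma mom_slope_le {R : realType} (a b q : R) (k : R -> R) : a < b ->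
  continuous_on a b k ->
  (forall u v, a <= u -> u <= v -> v <= b -> k v - k u <= q * (v - u)) ->
  mom a b k <= q * (b - a) / 12.
Proof.
move=> ab ck kn; have ba0 : 0 < b - a by rewrite subr_gt0.
(* The lower bound is applied to the negated kernel, written [0 - k u] so that [momB] applies. *)
have momN : mom a b (fun u => 0 - k u) = - mom a b k.
  rewrite momB//; last exact: continuous_on_cst.
  by rewrite /mom; under eq_Rintegral do rewrite mulr0; rewrite int_cst ?ltW// mul0r mulr0 sub0r.
have := @mom_slope_ge R a b (- q) (fun u => 0 - k u) ab.
rewrite momN => H; suff : - q * (b - a) / 12 <= - mom a b k by lra.
apply: H; first by apply: continuous_onD; [exact: continuous_on_cst|move=> u /ck; exact: cvgN].
by move=> u v au uv vb; have := kn u v au uv vb; lra.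
Qed.

(** Since |k u - k b / 2| <= k b / 2 and |u - c| <= (b - a) / 2 for the midpoint c, subtracting the
    constant k b / 2, which has no centred moment, bounds the integrand by (b - a) k b / 4. *)
Lemma mom_le {R : realType} (a b : R) (k : R -> R) : a < b ->
  continuous_on a b k -> (forall u, a <= u <= b -> 0 <= k u <= k b) ->
  mom a b k <= k b / 4.
Proof.
move=> ab ck kn; have ba0 : 0 < b - a by rewrite subr_gt0.
have [c cE] : exists c, c = (a + b) / 2 by exists ((a + b) / 2).
have := @aff_le R a b (- c) 1 k
   (fun u => ((- c) * (k b / 2) + b / 2 * (k b / 2) - a / 2 * (k b / 2) + (k b / 2) * u) * 1)
  ab ck (continuous_on_aff1 _ _ _ _).
have H u : a <= u <= b -> (- c + 1 * u) * k u <=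
   ((- c) * (k b / 2) + b / 2 * (k b / 2) - a / 2 * (k b / 2) + (k b / 2) * u) * 1.
  move=> /[dup]/kn /andP[k0 k1] /andP[au ub].
  have [e1 e2] : - (b - a) / 2 <= u - c /\ u - c <= (b - a) / 2 by split; lra.
  nra.
move=> /(_ H); rewrite int_aff// -cE mul1r addNr !mul0r add0r mul1r.
rewrite (_ : _ * (b - a) = (b - a) ^+ 2 * (k b / 4)); last by field.
by rewrite ler_pM2l// exprn_gt0.
Qed.

(** The kernel lies below its chord, whose average is the mean of the end values. *)
Lemma avg_trapezoid {R : realType} (a b : R) (k : R -> R) : a < b ->
  continuous_on a b k ->
  (forall u, a <= u <= b -> k u * (b - a) <= k a * (b - u) + k b * (u - a)) ->
  avg a b k <= (k a + k b) / 2.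
Proof.
move=> ab ck kn; have ba0 : 0 < b - a by rewrite subr_gt0.
have := @aff_le R a b (b - a) 0 k
  (fun u => (k a * b - k b * a + (k b - k a) * u) * 1)
  ab ck (continuous_on_aff1 _ _ _ _).
have H u : a <= u <= b -> (b - a + 0 * u) * k u <= (k a * b - k b * a + (k b - k a) * u) * 1.
  move=> /kn; lra.
move=> /(_ H); rewrite int_aff//.
rewrite (_ : (k a * b - _ + _) * _ = (b - a) ^+ 2 * ((k a + k b) / 2)); last by field.
rewrite (_ : _ + _ * mom a b k = (b - a) ^+ 2 * avg a b k); last by ring.
by rewrite ler_pM2l// exprn_gt0.
Qed.

(** * Convex kernels *)

(* The slope [q] is a subgradient at [c]; stating convexity as one-sided slope bounds
   compares the moments over the two mesh intervals that meet at [c]. *)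
Definition convex_kernel {R : realType} (b : R) (k : R -> R) : Prop :=
  [/\ forall u, u <= b -> {for u, continuous k},
      forall u, u <= b -> 0 <= k u &
      forall c, c <= b -> exists2 q, 0 <= q &
        (forall u v, u <= v -> v <= c -> k v - k u <= q * (v - u)) /\
        (forall u v, c <= u -> u <= v -> v <= b -> q * (v - u) <= k v - k u)].

Lemma convex_kernelW {R : realType} (b b' : R) (k : R -> R) :
  b' <= b -> convex_kernel b k -> convex_kernel b' k.
Proof.
move=> b'b [ck k0 sk]; split => [u ub|u ub|c cb].
- by apply: ck; lra.
- by apply: k0; lra.
- have [|q q0 [sl sr]] := sk c; first lra.
  by exists q => //; split => // u v cu uv vb; apply: sr => //; lra.
Qed.

Lemma convex_kernel_ndecr {R : realType} (b : R) (k : R -> R) u v :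
  convex_kernel b k -> u <= v -> v <= b -> k u <= k v.
Proof.
move=> [ck k0 sk] uv vb; have [|q q0 [_ sr]] := sk u; first lra.
have := sr u v (lexx _) uv vb; nra.
Qed.

Lemma convex_kernel_chord {R : realType} (b0 a b : R) (k : R -> R) u :
  convex_kernel b0 k -> b <= b0 -> a <= u <= b ->
  k u * (b - a) <= k a * (b - u) + k b * (u - a).
Proof.
move=> [ck k0 sk] bb /andP[au ub]; have [|q q0 [sl sr]] := sk u; first lra.
have := sr u b (lexx _) ub bb; have := sl a u au (lexx _); nra.
Qed.

(** * Power kernels and their singular integral *)

Lemma is_derive_powR_sub {R : realType} (x p u : R) : u < x ->
  is_derive u 1 (fun u => (x - u) `^ p) (- (p * (x - u) `^ (p - 1))).
Proof.
move=> ux; rewrite -(mulrN1 (p * _)).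
have xu : 0 < x - u by rewrite subr_gt0.
have d1 : is_derive (x - u) 1 (@powR R ^~ p) (p * (x - u) `^ (p - 1)) by exact: is_derive1_powR.
have d2 : is_derive u 1 (fun u => x - u) (-1). apply: is_derive_eq.
  by rewrite add0r mul1r.
exact: (@is_derive1_comp R (@powR R ^~ p) (fun u => x - u) u _ _ d1 d2).
Qed.

Lemma powR_sub_continuous {R : realType} (x p u : R) : u < x ->
  {for u, continuous (fun u => (x - u) `^ p)}.
Proof.
move=> /(is_derive_powR_sub x p u)[d _].
by apply/differentiable_continuous/derivable1_diffP.
Qed.

(* Both the kernel ([e = 0]) and the difference of two kernels ([e = 1]) have this form,
   which differentiation in [u] preserves, with [p] replaced by [p + 1]. *)
Definition kdiff {R : realType} (p x e y u : R) :=
  (x - u) `^ (- p) - e * (y - u) `^ (- p).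

Lemma kdiff_derive {R : realType} (p x e y u : R) : u < x -> u < y ->
  is_derive u 1 (kdiff p x e y) (p * kdiff (p + 1) x e y u).
Proof.
move=> ux uy; rewrite /kdiff.
have d1 := is_derive_powR_sub x (- p) u ux.
have d2 := is_derive_powR_sub y (- p) u uy.
apply: is_derive_eq.
by rewrite /GRing.scale/= opprD; ring.
Qed.

Lemma powRN_le {R : realType} (p u v : R) : 0 <= p -> 0 < u -> u <= v ->
  v `^ (- p) <= u `^ (- p).
Proof.
move=> p0 u0 uv; rewrite !powRN lef_pV2 ?posrE ?powR_gt0//; last lra.
by apply: ge0_ler_powR => //; rewrite nnegrE; lra.
Qed.

Lemma kdiff_ge0 {R : realType} (p x e y u : R) : 0 <= p -> 0 <= e <= 1 -> u < x -> x <= y ->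
  0 <= kdiff p x e y u.
Proof.
move=> p0 /andP[e0 e1] ux xy; rewrite /kdiff subr_ge0.
have : (y - u) `^ (- p) <= (x - u) `^ (- p) by apply: powRN_le => //; lra.
have := powR_ge0 (y - u) (- p); nra.
Qed.

Lemma kdiff_MVT {R : realType} (p x e y u v : R) : u <= v -> v < x -> x <= y ->
  exists2 c, u <= c <= v &
    kdiff p x e y v - kdiff p x e y u = p * kdiff (p + 1) x e y c * (v - u).
Proof.
move=> uv vx xy.
have D w : w <= v -> is_derive w 1 (kdiff p x e y) (p * kdiff (p + 1) x e y w).
  by move=> wv; apply: kdiff_derive; lra.
have [|||c] := @MVT_segment R (kdiff p x e y) (fun u => p * kdiff (p + 1) x e y u) u v.
- by [].
- by move=> w; rewrite in_itv/= => /andP[_ wv]; apply: D; lra.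
- apply: derivable_within_continuous => w; rewrite in_itv/= => /andP[_ wv].
  by have [] := D w wv.
- by rewrite in_itv/=; exists c.
Qed.

Lemma kdiff_ndecr {R : realType} (p x e y u v : R) : 0 <= p -> 0 <= e <= 1 ->
  u <= v -> v < x -> x <= y -> kdiff p x e y u <= kdiff p x e y v.
Proof.
move=> p0 e01 uv vx xy; rewrite -subr_ge0.
have [c /andP[uc cv] ->] := kdiff_MVT p x e y u v uv vx xy.
apply: mulr_ge0; last by rewrite subr_ge0.
by apply: mulr_ge0 => //; apply: kdiff_ge0 => //; lra.
Qed.

(** The derivative is [p] times a [kdiff] of exponent [p + 1], hence nonnegative and nondecreasing;
    by the mean value theorem its value at [c] serves as the subgradient. *)
Lemma kdiff_convex {R : realType} (p x e y b : R) : 0 <= p -> 0 <= e <= 1 ->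
  b < x -> x <= y -> convex_kernel b (kdiff p x e y).
Proof.
move=> p0 e01 bx xy; split => [u ub|u ub|c cb].
- have [||d _] := @kdiff_derive R p x e y u; [lra|lra|].
  exact/differentiable_continuous/derivable1_diffP.
- by apply: kdiff_ge0 => //; lra.
- have p1 : 0 <= p + 1 by lra.
  exists (p * kdiff (p + 1) x e y c).
    by rewrite mulr_ge0//; apply: kdiff_ge0 => //; lra.
  split=> u v.
  + move=> uv vc; have [||w /andP[uw wv] ->] := @kdiff_MVT R p x e y u v uv; [lra|lra|].
    rewrite ler_wpM2r ?subr_ge0// ler_wpM2l//; apply: kdiff_ndecr => //; lra.
  + move=> cu uv vb; have [||w /andP[uw wv] ->] := @kdiff_MVT R p x e y u v uv; [lra|lra|].
    rewrite ler_wpM2r ?subr_ge0// ler_wpM2l//; apply: kdiff_ndecr => //; lra.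
Qed.

Lemma powR_sub_convex {R : realType} (p x b : R) : 0 <= p -> b < x ->
  convex_kernel b (fun u => (x - u) `^ (- p)).
Proof.
move=> p0 bx; have := @kdiff_convex R p x 0 x b p0.
rewrite !lexx ler01 => /(_ isT bx isT); congr convex_kernel.
by apply/funext => u; rewrite /kdiff mul0r subr0.
Qed.

Lemma convex_kernel_continuous_on {R : realType} (a b b0 : R) (k : R -> R) :
  convex_kernel b0 k -> b <= b0 -> continuous_on a b k.
Proof. by move=> [ck _ _] bb u /andP[_ ub]; apply: ck; lra. Qed.

(** The integrand blows up at [x], so the fundamental theorem is used on [a, x - w n] and monotone
    convergence gives the limit. *)
Lemma integral_powR_singular {R : realType} (p a x : R) : 0 < p < 1 -> a < x ->
  (\int[lebesgue_measure]_(u in `[a, x]) ((x - u) `^ (- p))%:E =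
   ((x - a) `^ (1 - p) / (1 - p))%:E)%E.
Proof.
move=> /andP[p0 p1] ax.
have mf (D : set R) : measurable_fun D (fun u : R => (x - u) `^ (- p)).
  apply: (measurableT_comp (measurable_powR (- p))).
  exact: measurable_funB.
rewrite -integral_itv_bndo_bndc; last by apply/measurable_EFinP; exact: mf.
pose w n : R := (x - a) / n.+2%:R.
have w0 n : 0 < w n by rewrite divr_gt0// subr_gt0.
have wa n : a < x - w n.
  rewrite /w ltrBrDr -ltrBrDl ltr_pdivrMr// ltr_pMr ?subr_gt0//.
  by rewrite ltr1n.
have wle m n : (m <= n)%N -> w n <= w m.
  by move=> mn; rewrite /w ler_pM2l ?subr_gt0// lef_pV2 ?posrE// ler_nat.
have wcvg : w n @[n --> \oo] --> 0.
  rewrite /w -(mulr0 (x - a)); apply: cvgMr.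
  have := @cvg_harmonic R; rewrite -cvg_shiftS. exact.
pose F n := `[a, x - w n]%classic.
have FE : \bigcup_n F n = `[a, x[%classic.
  apply/seteqP; split => u /=.
    move=> [n _]; rewrite /F/= !in_itv/= => /andP[-> /= ux].
    by apply: le_lt_trans ux _; rewrite ltrBlDr ltrDl.
  rewrite in_itv/= => /andP[au ux].
  have : \forall n \near \oo, w n < x - u.
    by have := cvgr_lt _ wcvg; apply; rewrite subr_gt0.
  move=> [n _ /(_ n (leqnn _))] /= wn; exists n => //.
  by rewrite /F/= in_itv/= au/=; lra.
have intF : (\int[lebesgue_measure]_(u in F n) ((x - u) `^ (- p))%:E @[n --> \oo] -->
    \int[lebesgue_measure]_(u in \bigcup_n F n) ((x - u) `^ (- p))%:E)%E.
  apply: ge0_nondecreasing_set_cvg_integral => //.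
  - move=> m n mn; rewrite subsetEset => u; rewrite /F/= !in_itv/= => /andP[-> /= um].
    by apply: le_trans um _; rewrite lerB// wle.
  - by move=> i; exact: measurable_itv.
  - by move=> i; apply/measurable_EFinP; exact: mf.
  - by move=> i u _; rewrite lee_fin powR_ge0.
rewrite FE in intF.
have E n : (\int[lebesgue_measure]_(u in F n) ((x - u) `^ (- p))%:E =
    (((x - a) `^ (1 - p) - w n `^ (1 - p)) / (1 - p))%:E)%E.
  have c n' : continuous_on a (x - w n) (fun u => (x - u) `^ n').
    by move=> u /andP[_ uw]; apply: powR_sub_continuous; have := w0 n; lra.
  rewrite /F -[LHS]fineK; last first.
    by apply: integrable_fin_num => //; apply: continuous_on_integrable.
  congr EFin; have H := @int_FTC R a (x - w n) (fun u => (x - u) `^ (- p))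
       (fun u => - (1 - p)^-1 * (x - u) `^ (1 - p)) (wa n) (c _).
  apply: etrans (H _) _.
    move=> u /andP[_ uw]; have ux : u < x by have := w0 n; lra.
    have d := is_derive_powR_sub x (1 - p) u ux.
    apply: is_derive_eq; rewrite /GRing.scale/=.
    by rewrite (_ : 1 - p - 1 = - p); [field; lra|ring].
  by rewrite opprB addrCA subrr addr0; field; lra.
rewrite (funext E) in intF; apply: (cvg_unique _ intF) => //.
apply: cvg_EFin; first exact: nearW.
apply: cvgMl; rewrite -[X in _ --> X]subr0; apply: cvgB; first exact: cvg_cst.
(* The boundary term at x - w n vanishes because the exponent 1 - p is positive. *)
apply: ((cvg_at_rightP (fun y => y `^ (1 - p)) 0 0).1 _ w (conj w0 wcvg)).
by apply: powR_cvg0; rewrite subr_gt0.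
Qed.

(* Young's inequality, i.e. convexity of p |-> (7/4)^p between p = 0 and p = 1. *)
Lemma powR_74_le {R : realType} (p : R) : 0 < p < 1 -> (4 / 7) `^ (- p) <= 1 + 3 / 4 * p :> R.
Proof.
move=> /andP[p0 p1].
have := @conjugate_powR R ((4 / 7) `^ (- p)) 1 p^-1 (1 - p)^-1.
rewrite mulr1 powR1 -powRrM mulNr divff ?gt_eqF//.
rewrite powR_ge0 ler01 !invr_gt0 subr_gt0 !invrK => /(_ isT isT p0 p1).
rewrite powR_inv1; last lra.
by move=> H; apply: le_trans (H _) _; [ring|lra].
Qed.

(** * The L2-1_sigma functionals on a mesh *)

Definition mesh {R : realType} (t : nat -> R) (N : nat) : Prop :=
  (forall k, (k < N)%N -> t k < t k.+1) /\
  (forall k, (2 <= k <= N)%N -> 4 / 7 <= step_ratio t k).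

Definition mavg {R : realType} (t : nat -> R) (k : R -> R) j := avg (t j.-1) (t j) k.
Definition mmom {R : realType} (t : nat -> R) (k : R -> R) j := mom (t j.-1) (t j) k.

(* [back_moment] is the paper's b_(n-j+1)/r_j and [quad_coef] its B_(n-j), j < n, without
   the factor 1/Gamma(1 - alpha). *)
Definition back_moment {R : realType} (t : nat -> R) (k : R -> R) j : R :=
  if j == 1%N then 0
  else 2 / (step_ratio t j * (1 + step_ratio t j)) * mmom t k j.-1.

Definition quad_coef {R : realType} (t : nat -> R) (k : R -> R) j : R :=
  mavg t k j + back_moment t k j - 2 / (1 + step_ratio t j.+1) * mmom t k j.

Lemma mesh_step {R : realType} (t : nat -> R) (N k : nat) : mesh t N ->
  (0 < k <= N)%N -> t k.-1 < t k.
Proof. by move=> [mt _]; case: k => //= k /mt. Qed.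

Lemma mesh_le {R : realType} (t : nat -> R) (N j k : nat) : mesh t N ->
  (j <= k <= N)%N -> t j <= t k.
Proof.
move=> [mt _] /andP[]; elim: k => [|k IH]; first by rewrite leqn0 => /eqP ->.
rewrite leq_eqVlt => /predU1P[->//|jk kN]; apply: le_trans (IH jk (ltnW kN)) _.
exact/ltW/mt.
Qed.

Lemma mmom_ge0 {R : realType} (t : nat -> R) (N j : nat) (k : R -> R) :
  mesh t N -> (0 < j <= N)%N -> convex_kernel (t j) k -> 0 <= mmom t k j.
Proof.
move=> mt jN ck.
have := @mom_slope_ge R (t j.-1) (t j) 0 k (mesh_step _ _ _ mt jN).
rewrite !mul0r; apply; first exact: (convex_kernel_continuous_on _ _ _ _ ck).
by move=> u v _ uv vb; rewrite mul0r subr_ge0; apply: convex_kernel_ndecr ck uv vb.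
Qed.

(** A subgradient q at the common node t_(j-1) bounds the slopes from below on the right interval
    and from above on the left one. The two moments are thus separated by q times the respective
    step over 12. *)
Lemma mmom_ratio {R : realType} (t : nat -> R) (N j : nat) (k : R -> R) :
  mesh t N -> (2 <= j <= N)%N -> convex_kernel (t j) k ->
  step_ratio t j * mmom t k j.-1 <= mmom t k j.
Proof.
move=> mt /andP[j2 jN] ck.
have s1 : t j.-1 < t j by apply: mesh_step mt _; lia.
have s2 : t j.-1.-1 < t j.-1 by apply: mesh_step mt _; lia.
have [c0 k0 /(_ _ (ltW s1))[q q0 [sl sr]]] := ck.
have cont a b : b <= t j -> continuous_on a b k.
  by move=> bt; apply: convex_kernel_continuous_on ck bt.
have H1 : q * (t j - t j.-1) / 12 <= mmom t k j.
  by apply: mom_slope_ge => //; apply: cont.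
have H2 : mmom t k j.-1 <= q * (t j.-1 - t j.-1.-1) / 12.
  by apply: mom_slope_le => //; [apply: cont; lra|move=> u v _ uv vb; apply: sl].
apply: le_trans H1; rewrite /step_ratio /step mulrAC ler_pdivrMr ?subr_gt0//.
have : 0 < t j - t j.-1 by lra.
nra.
Qed.

Lemma mesh_ratio {R : realType} (t : nat -> R) (N k : nat) : mesh t N ->
  (2 <= k <= N)%N -> 4 / 7 <= step_ratio t k.
Proof. by move=> [_ H]; exact: H. Qed.

(** The factor 2 / (r^2 (1 + r)) is largest at r = 4/7, where it equals 343/88. *)
Lemma back_coef_le {R : realType} (r x y : R) : 4 / 7 <= r -> 0 <= x -> r * x <= y ->
  0 <= 2 / (r * (1 + r)) * x <= 343 / 88 * y.
Proof.
move=> r47 x0 rxy; have r0 : 0 < r * (1 + r) by nra.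
apply/andP; split; first by rewrite mulr_ge0// divr_ge0//; lra.
rewrite mulrAC ler_pdivrMr//.
have h1 : (4 / 7) * (1 + 4 / 7) <= r * (1 + r) by nra.
have h2 : 2 <= 343 / 88 * (r * (1 + r)) * r by nra.
have h3 : 2 * x <= 343 / 88 * (r * (1 + r)) * (r * x) by nra.
by apply: le_trans h3 _; nra.
Qed.

Lemma back_moment_bound {R : realType} (t : nat -> R) (N j : nat) (k : R -> R) :
  mesh t N -> (0 < j <= N)%N -> convex_kernel (t j) k ->
  0 <= back_moment t k j <= 343 / 88 * mmom t k j.
Proof.
move=> mt jN ck; have m0 := mmom_ge0 _ _ _ _ mt jN ck.
rewrite /back_moment; case: eqP => j1; first by rewrite lexx/=; lra.
have j2 : (2 <= j <= N)%N by lia.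
apply: back_coef_le.
- by apply: mesh_ratio mt j2.
- apply: (mmom_ge0 _ _ _ _ mt); first lia.
  by apply: convex_kernelW ck; apply/ltW; apply: mesh_step mt _; lia.
- by apply: mmom_ratio mt j2 ck.
Qed.

Lemma mavg_bounds {R : realType} (t : nat -> R) (N j : nat) (k : R -> R) :
  mesh t N -> (0 < j <= N)%N -> convex_kernel (t j) k ->
  k (t j.-1) + 2 * mmom t k j <= mavg t k j /\ mavg t k j + 2 * mmom t k j <= k (t j).
Proof.
move=> mt jN ck; have s := mesh_step _ _ _ mt jN.
have cont := convex_kernel_continuous_on (t j.-1) _ _ _ ck (lexx _).
split.
  by apply: avg_mom_ge => // u /andP[au ub]; apply: convex_kernel_ndecr ck au ub.
by apply: avg_mom_le => // u /andP[au ub]; apply: convex_kernel_ndecr ck ub (lexx _).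
Qed.

Lemma mmom_le {R : realType} (t : nat -> R) (N j : nat) (k : R -> R) :
  mesh t N -> (0 < j <= N)%N -> convex_kernel (t j) k -> mmom t k j <= k (t j) / 4.
Proof.
move=> mt jN ck; apply: mom_le.
- by apply: mesh_step mt jN.
- by apply: convex_kernel_continuous_on ck (lexx _).
- move=> u /andP[_ ub]; apply/andP; split; first by case: ck => _ k0 _; exact: k0.
  by apply: convex_kernel_ndecr ck ub (lexx _).
Qed.

Lemma mavg_trapezoid {R : realType} (t : nat -> R) (N j : nat) (k : R -> R) :
  mesh t N -> (0 < j <= N)%N -> convex_kernel (t j) k ->
  mavg t k j <= (k (t j.-1) + k (t j)) / 2.
Proof.
move=> mt jN ck; apply: avg_trapezoid.
- by apply: mesh_step mt jN.
- by apply: convex_kernel_continuous_on ck (lexx _).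
- by move=> u; apply: convex_kernel_chord ck (lexx _).
Qed.

Lemma ratio_coef_le {R : realType} (r : R) : 4 / 7 <= r -> 0 <= 2 / (1 + r) <= 14 / 11.
Proof.
move=> r47; have r0 : 0 < 1 + r by lra.
by apply/andP; split; [apply: divr_ge0; lra|rewrite ler_pdivrMr//; lra].
Qed.

(** Here 8/11 = 2 - 14/11, with 14/11 the bound of [ratio_coef_le]. After replacing [c'] by [r * c]
    and multiplying by [r], a quadratic in [r] of negative discriminant remains. *)
Lemma interior_coef_ge {R : realType} (r c c' : R) : 4 / 7 <= r -> 0 <= c ->
  r * c <= c' -> 0 <= 8 / 11 * c' + 2 * c + 2 / r * c - 343 / 88 * c.
Proof.
move=> r47 c0 cc; have r0 : 0 < r by lra.
rewrite (_ : _ - _ = 8 / 11 * c' + (2 + 2 / r - 343 / 88) * c); last by ring.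
suff : 0 <= 8 / 11 * r + (2 + 2 / r - 343 / 88) by nra.
rewrite -(pmulr_rge0 _ r0).
have -> : r * (8 / 11 * r + (2 + 2 / r - 343 / 88)) =
  8 / 11 * r ^+ 2 - 167 / 88 * r + 2 by field; lra.
(* The minimum of the quadratic is at r = 167/128. *)
have := sqr_ge0 (r - 167 / 128); lra.
Qed.

(** In the arithmetic lemmas [A] stands for averages, [b] for back moments, [m] for moments, [z] for
    forward moment terms and [g] for a kernel value at a node. *)
Lemma interior_arith {R : realType} (A A' b x y z m m' g : R) :
  z <= 14 / 11 * m -> 0 <= 8 / 11 * m + 2 * m' + x - 343 / 88 * m' ->
  g + 2 * m <= A -> A' + 2 * m' <= g -> b <= 343 / 88 * m' ->
  A' + b - y <= A + (x - y) - z.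
Proof. lra. Qed.

Lemma diag_arith {R : realType} (A b b' z m g a : R) :
  g <= a -> A + 2 * m <= g -> b <= 343 / 88 * m -> m <= g / 4 -> 0 <= m ->
  0 <= b' -> 0 <= z -> A + b - z <= 2 * (a + b').
Proof. lra. Qed.

(** [Ad], [bd], [md], [zd] and [bd0] belong to the difference of two kernels; [g'] and [h'] are the
    values of the later kernel at the ends of the last interval. *)
Lemma diag_step_arith {R : realType} (A b Ad bd m md z zd b1 bd0 g g' h' Q Q' ag a : R) :
  2 * g + ag <= 2 * a -> h' <= g + 3 / 4 * ag -> 0 <= ag -> 0 <= g' -> 0 <= g ->
  A <= (g' + h') / 2 -> 0 <= z -> 0 <= zd ->
  Ad + 2 * md <= g - g' -> bd <= 343 / 88 * md -> 0 <= md -> md <= (g - g') / 4 ->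
  0 <= b1 -> 0 <= bd0 -> bd0 = b1 - b -> Ad + bd - zd = Q - Q' ->
  A + b - z - Q' <= 2 * (a + b1) - Q.
Proof. lra. Qed.

(** The value of [k] at the common node t_(j-1) separates the two averages, with a margin of twice
    each moment. This margin absorbs the negative moment terms by [interior_coef_ge]. *)
Lemma quad_coef_ndecr {R : realType} (t : nat -> R) (N j : nat) (k : R -> R) :
  mesh t N -> (2 <= j < N)%N -> convex_kernel (t j) k ->
  quad_coef t k j.-1 <= quad_coef t k j.
Proof.
move=> mt jN ck.
have j0 : (0 < j)%N by lia.
have j1 : (j == 1%N) = false by lia.
have j1N : (0 < j <= N)%N by lia.
have j2N : (0 < j.-1 <= N)%N by lia.
have jj : (2 <= j <= N)%N by lia.
have jj1 : (2 <= j.+1 <= N)%N by lia.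
have s1 := mesh_step _ _ _ mt j1N.
have ck1 := convex_kernelW _ _ _ (ltW s1) ck.
have [A1 _] := mavg_bounds _ _ _ _ mt j1N ck.
have [_ A2] := mavg_bounds _ _ _ _ mt j2N ck1.
have /andP[_ b] := back_moment_bound _ _ _ _ mt j2N ck1.
have m1 := mmom_ge0 _ _ _ _ mt j1N ck.
have m2 := mmom_ge0 _ _ _ _ mt j2N ck1.
have r1 := mesh_ratio _ _ _ mt jj.
have mr := mmom_ratio _ _ _ _ mt jj ck.
have /andP[_ rc] := ratio_coef_le _ (mesh_ratio _ _ _ mt jj1).
(* Partial fractions: the second term cancels the forward moment term of [quad_coef t k j.-1]. *)
have bE : back_moment t k j = 2 / step_ratio t j * mmom t k j.-1
    - 2 / (1 + step_ratio t j) * mmom t k j.-1.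
  rewrite /back_moment j1 -mulrBl; congr (_ * _).
  by move: r1; clear; move=> r1; field; lra.
rewrite /quad_coef prednK// bE.
exact: (interior_arith _ _ _ _ _ _ _ _ _ (ler_wpM2r m1 rc)
  (interior_coef_ge _ _ _ r1 m2 mr) A1 A2 b).
Qed.

(** The first interval has no back moment, and the average is at least twice the moment while the
    subtracted term is at most 14/11 of it. *)
Lemma quad_coef1_ge0 {R : realType} (t : nat -> R) (N : nat) (k : R -> R) :
  mesh t N -> (1 < N)%N -> convex_kernel (t 1%N) k -> 0 <= quad_coef t k 1.
Proof.
move=> mt N1 ck; have jN : (0 < 1 <= N)%N by lia.
have jN2 : (2 <= 2 <= N)%N by lia.
have jN0 : (0 <= 1 <= N)%N by lia.
have [A1 _] := mavg_bounds _ _ _ _ mt jN ck.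
have m1 := mmom_ge0 _ _ _ _ mt jN ck.
have /andP[_ rc] := ratio_coef_le _ (mesh_ratio _ _ _ mt jN2).
have k0 : 0 <= k (t 0%N) by case: ck => _ H _; apply: H; apply: mesh_le mt jN0.
rewrite /quad_coef /back_moment eqxx addr0 subr_ge0.
apply: le_trans (ler_wpM2r m1 rc) _; apply: le_trans A1 => /=.
by move: m1 k0; clear; move=> m1 k0; lra.
Qed.

Lemma quad_coefB {R : realType} (t : nat -> R) (N j : nat) (k k' : R -> R) :
  mesh t N -> (0 < j <= N)%N -> convex_kernel (t j) k -> convex_kernel (t j) k' ->
  quad_coef t (fun u => k u - k' u) j = quad_coef t k j - quad_coef t k' j.
Proof.
move=> mt jN ck ck'.
have cont i f : (i <= j)%N -> convex_kernel (t j) f -> continuous_on (t i.-1) (t i) f.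
  by move=> ij cf; apply: (convex_kernel_continuous_on _ _ _ _ cf); apply: mesh_le mt _; lia.
have j1 : (j.-1 <= j)%N := leq_pred j.
have E1 := momB _ _ _ _ (cont _ _ (leqnn j) ck) (cont _ _ (leqnn j) ck').
have E2 := momB _ _ _ _ (cont _ _ j1 ck) (cont _ _ j1 ck').
have E3 := avgB _ _ _ _ (cont _ _ (leqnn j) ck) (cont _ _ (leqnn j) ck').
rewrite /quad_coef /back_moment /mavg /mmom E1 E2 E3.
by case: eqP => _; ring.
Qed.

Lemma back_momentB {R : realType} (t : nat -> R) (N j : nat) (k k' : R -> R) :
  mesh t N -> (0 < j <= N)%N -> convex_kernel (t j.-1) k -> convex_kernel (t j.-1) k' ->
  back_moment t (fun u => k u - k' u) j = back_moment t k j - back_moment t k' j.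
Proof.
move=> mt jN ck ck'.
rewrite /back_moment /mmom; case: eqP => _; first by rewrite subr0.
have cont f : convex_kernel (t j.-1) f -> continuous_on (t j.-1.-1) (t j.-1) f.
  by move=> cf; apply: convex_kernel_continuous_on cf _.
by rewrite momB ?mulrBr//; exact: cont.
Qed.

Lemma back_moment_ge0 {R : realType} (t : nat -> R) (N j : nat) (k : R -> R) :
  mesh t N -> (0 < j <= N)%N -> convex_kernel (t j.-1) k -> 0 <= back_moment t k j.
Proof.
move=> mt jN ck; rewrite /back_moment; case: eqP => // j1.
have r : 4 / 7 <= step_ratio t j by apply: mesh_ratio mt _; lia.
apply: mulr_ge0; first by rewrite divr_ge0// mulr_ge0//; lra.
by apply: mmom_ge0 mt _ ck; lia.
Qed.

(** With g = k (t n.-1), average and back moment together are at most g + (343/88 - 2) m, and m <= g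
    / 4 keeps this below 2 g. *)
Lemma diag_coef_ge {R : realType} (t : nat -> R) (N n : nat) (k : R -> R) (a : R) :
  mesh t N -> (2 <= n <= N)%N -> convex_kernel (t n.-1) k -> k (t n.-1) <= a ->
  quad_coef t k n.-1 <= 2 * (a + back_moment t k n).
Proof.
move=> mt nN ck ka.
have jN : (0 < n.-1 <= N)%N by lia.
have n0 : (0 < n <= N)%N by lia.
have [_ A2] := mavg_bounds _ _ _ _ mt jN ck.
have /andP[_ b] := back_moment_bound _ _ _ _ mt jN ck.
have m0 := mmom_ge0 _ _ _ _ mt jN ck.
have m4 := mmom_le _ _ _ _ mt jN ck.
have b0 := back_moment_ge0 _ _ _ _ mt n0 ck.
have /andP[rc _] := ratio_coef_le _ (mesh_ratio _ _ _ mt nN).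
rewrite /quad_coef prednK; last by case/andP: n0.
exact: (diag_arith _ _ _ _ _ _ _ ka A2 b m4 m0 b0 (mulr_ge0 rc m0)).
Qed.

(** By linearity the two coefficients at [n.-1] combine into that of [k - k']. With g = k (t n.-1),
    this is at most (1 + 167/352)(g - k' (t n.-1)), as in [diag_coef_ge]. The trapezoid bound halves
    the contribution of k' (t n), so the factors of g add up to 695/352 + 3/8 alpha < 2 + alpha. *)
Lemma diag_coef_step {R : realType} (t : nat -> R) (N n : nat) (k k' : R -> R) (alpha a : R) :
  mesh t N -> (2 <= n < N)%N -> 0 <= alpha ->
  convex_kernel (t n.-1) k -> convex_kernel (t n) k' ->
  convex_kernel (t n.-1) (fun u => k u - k' u) ->
  (2 + alpha) * k (t n.-1) <= 2 * a ->
  k' (t n) <= (1 + 3 / 4 * alpha) * k (t n.-1) ->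
  quad_coef t k' n - quad_coef t k' n.-1 <= 2 * (a + back_moment t k n) - quad_coef t k n.-1.
Proof.
move=> mt nN a0 ck ck' cd ka k'k.
have jN : (0 < n.-1 <= N)%N by lia.
have n0 : (0 < n <= N)%N by lia.
have n2 : (2 <= n <= N)%N by lia.
have n3 : (2 <= n.+1 <= N)%N by lia.
have n1 : n.-1.+1 = n by lia.
have s1 := mesh_step _ _ _ mt n0.
have ck'1 := convex_kernelW _ _ _ (ltW s1) ck'.
have QE := quad_coefB _ _ _ _ _ mt jN ck ck'1.
have bE := back_momentB _ _ _ _ _ mt n0 ck ck'1.
have [_ A2] := mavg_bounds _ _ _ _ mt jN cd.
have /andP[_ b] := back_moment_bound _ _ _ _ mt jN cd.
have m0 := mmom_ge0 _ _ _ _ mt jN cd.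
have m0' := mmom_ge0 _ _ _ _ mt n0 ck'.
have m4 := mmom_le _ _ _ _ mt jN cd.
have b0 := back_moment_ge0 _ _ _ _ mt n0 cd.
have b1 := back_moment_ge0 _ _ _ _ mt n0 ck.
have T := mavg_trapezoid _ _ _ _ mt n0 ck'.
have k'0 : 0 <= k' (t n.-1) by case: ck'1 => _ H _; exact: H.
have k0 : 0 <= k (t n.-1) by case: ck => _ H _; exact: H.
have /andP[rc _] := ratio_coef_le _ (mesh_ratio _ _ _ mt n2).
have /andP[rc' _] := ratio_coef_le _ (mesh_ratio _ _ _ mt n3).
have rm := mulr_ge0 rc m0.
have rm' := mulr_ge0 rc' m0'.
have ak : 0 <= alpha * k (t n.-1) by rewrite mulr_ge0.
rewrite {1}/quad_coef in QE; rewrite n1 in QE.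
rewrite mulrDl in ka; rewrite mulrDl mul1r -mulrA in k'k.
rewrite {1}/quad_coef.
exact: (diag_step_arith _ _ _ _ _ _ _ _ _ _ _ _ _ _ _ _ _ ka k'k ak k'0 k0 T rm' rm
  A2 b m0 m4 b1 b0 bE QE).
Qed.

Lemma quad_coef1_arith {R : realType} (A z h g ag m a : R) :
  2 * g + ag <= 2 * a -> h <= g + 3 / 4 * ag -> 0 <= ag -> 0 <= g -> 0 <= m ->
  A + 2 * m <= h -> 0 <= z -> A - z <= 2 * a.
Proof. lra. Qed.

Lemma diag_coef_step1 {R : realType} (t : nat -> R) (N : nat) (k' : R -> R) (alpha g a : R) :
  mesh t N -> (1 < N)%N -> 0 <= alpha -> 0 <= g ->
  convex_kernel (t 1%N) k' -> (2 + alpha) * g <= 2 * a ->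
  k' (t 1%N) <= (1 + 3 / 4 * alpha) * g ->
  quad_coef t k' 1 <= 2 * a.
Proof.
move=> mt N1 a0 g0 ck ka k'k; have jN : (0 < 1 <= N)%N by lia.
have jN2 : (2 <= 2 <= N)%N by lia.
have [_ A1] := mavg_bounds _ _ _ _ mt jN ck.
have m1 := mmom_ge0 _ _ _ _ mt jN ck.
have /andP[rc _] := ratio_coef_le _ (mesh_ratio _ _ _ mt jN2).
have rm := mulr_ge0 rc m1.
have ag : 0 <= alpha * g by rewrite mulr_ge0.
rewrite mulrDl in ka; rewrite mulrDl mul1r -mulrA in k'k.
rewrite /quad_coef /back_moment eqxx addr0.
exact: (quad_coef1_arith _ _ _ _ _ _ _ ka k'k ag g0 m1 A1 rm).
Qed.

(** * Positivity of the quadratic form *)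

Lemma abel_summation {R : comPzRingType} (A w : nat -> R) (n : nat) : A 0%N = 0 ->
  \sum_(1 <= j < n.+1) (A j - A j.-1) * (\sum_(j <= l < n.+1) w l) =
  \sum_(1 <= j < n.+1) A j * w j.
Proof.
move=> A0; elim: n => [|n IH]; first by rewrite !big_geq.
have T : \sum_(1 <= j < n.+2) (A j - A j.-1) = A n.+1.
  by rewrite big_add1 (telescope_sumr (fun j => A j))//= A0 subr0.
have -> : \sum_(1 <= j < n.+2) (A j - A j.-1) * (\sum_(j <= l < n.+2) w l) =
  \sum_(1 <= j < n.+2) ((A j - A j.-1) * (\sum_(j <= l < n.+1) w l) + (A j - A j.-1) * w n.+1).
  by apply: eq_big_nat => j jn; rewrite (big_nat_recr n.+1)/= ?mulrDr//; lia.
rewrite big_split/= -mulr_suml T big_nat_recr//= (big_geq (leqnn n.+1)) mulr0 addr0.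
by rewrite IH [RHS]big_nat_recr.
Qed.

(** The value 0 at j = 0 is the boundary value that [abel_summation] requires. *)
Definition doubled {R : realType} (B : nat -> nat -> R) (n j : nat) : R :=
  if j == 0%N then 0 else if j == n then 2 * B n n else B n j.

(** For a tail sum S ending in w = w_(n+1), S^2 - (S - w)^2 = 2 w S - w^2. Weighted by [a], the
    first term gives the row plus an extra diagonal entry by Abel summation; the second telescopes
    to twice the diagonal and removes this extra entry. *)
Lemma kernel_form_step {R : realType} (B : nat -> nat -> R) (w : nat -> R) (n : nat) :
  let a j := doubled B n.+1 j - doubled B n.+1 j.-1 in
  w n.+1 * (\sum_(1 <= j < n.+2) B n.+1 j * w j) =
  (\sum_(1 <= j < n.+2) a j * (\sum_(j <= l < n.+2) w l) ^+ 2 -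
   \sum_(1 <= j < n.+1) a j * (\sum_(j <= l < n.+1) w l) ^+ 2) / 2.
Proof.
move=> a.
have Ab := @abel_summation R (doubled B n.+1) w n.+1 erefl.
have T : \sum_(1 <= j < n.+2) a j = 2 * B n.+1 n.+1.
  by rewrite big_add1 (telescope_sumr (fun j => doubled B n.+1 j))//= /doubled/= eqxx subr0.
have S : \sum_(1 <= j < n.+2) doubled B n.+1 j * w j =
    \sum_(1 <= j < n.+2) B n.+1 j * w j + B n.+1 n.+1 * w n.+1.
  rewrite !(big_nat_recr n.+1)//= {2}/doubled/= eqxx.
  rewrite -addrA; congr (_ + _); last by ring.
  by apply: eq_big_nat => j jn; rewrite /doubled !ifF//; apply/eqP; lia.
(* The added index j = n + 1 contributes an empty tail sum. *)
have -> : \sum_(1 <= j < n.+1) a j * (\sum_(j <= l < n.+1) w l) ^+ 2 =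
    \sum_(1 <= j < n.+2) a j * (\sum_(j <= l < n.+1) w l) ^+ 2.
  by rewrite [RHS]big_nat_recr//= (big_geq (leqnn n.+1)) expr0n/= mulr0 addr0.
rewrite -sumrB.
have -> : \sum_(1 <= j < n.+2) (a j * (\sum_(j <= l < n.+2) w l) ^+ 2 -
     a j * (\sum_(j <= l < n.+1) w l) ^+ 2) =
   \sum_(1 <= j < n.+2) (2 * w n.+1 * (a j * (\sum_(j <= l < n.+2) w l)) - w n.+1 ^+ 2 * a j).
  apply: eq_big_nat => j jn.
  by rewrite (big_nat_recr n.+1)//=; [ring|lia].
by rewrite sumrB -!mulr_sumr T Ab S; field.
Qed.

Lemma kernel_form_ge0 {R : realType} (B : nat -> nat -> R) (N : nat) :
  (forall n j, (0 < j <= n)%N -> (n <= N)%N -> doubled B n j.-1 <= doubled B n j) ->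
  (forall n j, (0 < j <= n)%N -> (n < N)%N ->
     doubled B n.+1 j - doubled B n.+1 j.-1 <= doubled B n j - doubled B n j.-1) ->
  forall n (w : nat -> R), (n <= N)%N ->
  0 <= \sum_(1 <= k < n.+1) w k * (\sum_(1 <= j < k.+1) B k j * w j).
Proof.
move=> P Q n w nN; pose a n j := doubled B n j - doubled B n j.-1.
(* The induction carries this sum of squares as a lower bound; monotonicity in n lets row n + 1
   replace row n in it. *)
suff H : (\sum_(1 <= j < n.+1) a n j * (\sum_(j <= l < n.+1) w l) ^+ 2) / 2 <=
    \sum_(1 <= k < n.+1) w k * (\sum_(1 <= j < k.+1) B k j * w j).
  apply: le_trans H; rewrite divr_ge0// big_nat_cond sumr_ge0// => j /andP[jn _].
  by rewrite mulr_ge0 ?sqr_ge0// subr_ge0 P//; lia.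
elim: n nN => [|n IH] nN; first by rewrite !big_geq// mul0r.
rewrite [leRHS]big_nat_recr//= kernel_form_step -lerBlDr.
apply: le_trans (IH (ltnW nN)).
rewrite -mulrBl opprB addrCA subrr addr0 ler_pM2r ?invr_gt0//.
rewrite big_nat_cond [leRHS]big_nat_cond ler_sum// => j /andP[jn _].
by rewrite ler_wpM2r ?sqr_ge0// Q//; lia.
Qed.

(** * The coefficients of the scheme in terms of the singular kernel *)

Definition skernel {R : realType} (alpha : R) (t : nat -> R) (n : nat) (u : R) : R :=
  (tshift t (alpha / 2) n - u) `^ (- alpha).

(** The closed form of the singular integral over [t_(n-1), t_(n-sigma)], divided by the full step:
    a_0^(n) up to the Gamma factor. *)
Definition head_coef {R : realType} (alpha : R) (t : nat -> R) (n : nat) : R :=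
  (step t n)^-1 * ((tshift t (alpha / 2) n - t n.-1) `^ (1 - alpha) / (1 - alpha)).

Definition scaled_coef {R : realType} (alpha : R) (t : nat -> R) (n k : nat) : R :=
  if k == n then head_coef alpha t n + back_moment t (skernel alpha t n) n
  else quad_coef t (skernel alpha t n) k.

Lemma tshift_sub {R : realType} (alpha : R) (t : nat -> R) n :
  tshift t (alpha / 2) n - t n.-1 = (1 - alpha / 2) * step t n.
Proof. by rewrite /tshift /step; field. Qed.

Lemma tshift_gt {R : realType} (alpha : R) (t : nat -> R) (N j n : nat) :
  0 < alpha < 1 -> mesh t N -> (0 < n <= N)%N -> (j < n)%N -> t j < tshift t (alpha / 2) n.
Proof.
move=> /andP[a0 a1] mt nN jn.
have s : t n.-1 < t n by apply: mesh_step mt _.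
have : t j <= t n.-1 by apply: mesh_le mt _; lia.
have := tshift_sub alpha t n; have : 0 < step t n by rewrite subr_gt0.
nra.
Qed.

Lemma tshift_lt {R : realType} (alpha : R) (t : nat -> R) (N n : nat) :
  0 < alpha < 1 -> mesh t N -> (0 < n <= N)%N -> tshift t (alpha / 2) n < t n.
Proof.
move=> /andP[a0 a1] mt nN.
have s : t n.-1 < t n by apply: mesh_step mt _.
by rewrite /tshift; nra.
Qed.

Lemma tshift_step_le {R : realType} (alpha : R) (t : nat -> R) (N n : nat) :
  0 < alpha < 1 -> mesh t N -> (0 < n < N)%N -> tshift t (alpha / 2) n <= tshift t (alpha / 2) n.+1.
Proof.
move=> a01 mt nN; apply: ltW; apply: lt_trans (_ : t n < _).
  by apply: tshift_lt a01 mt _; lia.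
by apply: tshift_gt a01 mt _ _; lia.
Qed.

Lemma skernel_convex {R : realType} (alpha : R) (t : nat -> R) (N j n : nat) :
  0 < alpha < 1 -> mesh t N -> (0 < n <= N)%N -> (j < n)%N ->
  convex_kernel (t j) (skernel alpha t n).
Proof.
move=> a01 mt nN jn; apply: powR_sub_convex; first by case/andP: a01 => /ltW.
exact: tshift_gt a01 mt nN jn.
Qed.

Lemma skernelB_convex {R : realType} (alpha : R) (t : nat -> R) (N j n : nat) :
  0 < alpha < 1 -> mesh t N -> (0 < n < N)%N -> (j < n)%N ->
  convex_kernel (t j) (fun u => skernel alpha t n u - skernel alpha t n.+1 u).
Proof.
move=> a01 mt nN jn.
have tn : t j < tshift t (alpha / 2) n by apply: tshift_gt a01 mt _ jn; lia.
have := @kdiff_convex R alpha (tshift t (alpha / 2) n) 1 (tshift t (alpha / 2) n.+1) (t j).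
rewrite ler01 lexx => /(_ _ isT tn (tshift_step_le _ _ _ _ a01 mt nN)) H.
rewrite (_ : (fun u => _) =
  kdiff alpha (tshift t (alpha / 2) n) 1 (tshift t (alpha / 2) n.+1)).
  by apply: H; case/andP: a01 => /ltW.
by apply/funext => u; rewrite /kdiff mul1r.
Qed.

(** Twice the head coefficient is (2 - alpha) / (1 - alpha) times the kernel value, and (2 +
    alpha)(1 - alpha) <= 2 - alpha. *)
Lemma head_coef_ge {R : realType} (alpha : R) (t : nat -> R) (N n : nat) :
  0 < alpha < 1 -> mesh t N -> (0 < n <= N)%N ->
  (2 + alpha) * skernel alpha t n (t n.-1) <= 2 * head_coef alpha t n.
Proof.
move=> /andP[a0 a1] mt nN.
have s : 0 < step t n by rewrite subr_gt0; apply: mesh_step mt _.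
rewrite /head_coef /skernel tshift_sub.
set z := (1 - alpha / 2) * step t n.
have z0 : 0 < z by rewrite /z; nra.
rewrite powRD ?(powRr1 (ltW z0)); last by rewrite (gt_eqF z0) implybT.
have g0 : 0 < z `^ (- alpha) by exact: powR_gt0.
rewrite (_ : 2 * _ = (2 - alpha) / (1 - alpha) * z `^ (- alpha)); last first.
  by rewrite {1}/z; field; rewrite ?gt_eqF//; lra.
rewrite ler_pM2r// ler_pdivlMr; nra.
Qed.

(** Each kernel is evaluated at distance (1 - alpha/2) times its own step from its singularity, so
    the quotient is r_(n+1)^(-alpha), at most (4/7)^(-alpha). *)
Lemma skernel_next_le {R : realType} (alpha : R) (t : nat -> R) (N n : nat) :
  0 < alpha < 1 -> mesh t N -> (0 < n < N)%N ->
  skernel alpha t n.+1 (t n) <= (1 + 3 / 4 * alpha) * skernel alpha t n (t n.-1).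
Proof.
move=> a01 mt nN; have [a0 a1] := andP a01.
have s : 0 < step t n by rewrite subr_gt0; apply: mesh_step mt _; lia.
have r : 4 / 7 <= step_ratio t n.+1 by apply: mesh_ratio mt _; lia.
have := tshift_sub alpha t n.+1; rewrite /= => e.
rewrite /skernel e tshift_sub.
set z := (1 - alpha / 2) * step t n.
have z0 : 0 < z by rewrite /z; nra.
have zz : 4 / 7 * z <= (1 - alpha / 2) * step t n.+1.
  rewrite /z mulrCA ler_wpM2l//; first by lra.
  by move: r; rewrite /step_ratio/= ler_pdivlMr.
apply: le_trans (powRN_le _ _ _ (ltW a0) _ zz) _; first by rewrite mulr_gt0//; lra.
rewrite powRM; [|lra|exact: ltW].
by rewrite ler_wpM2r ?powR_ge0// powR_74_le.
Qed.

Lemma head_coef_ge_kernel {R : realType} (alpha : R) (t : nat -> R) (N n : nat) :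
  0 < alpha < 1 -> mesh t N -> (0 < n <= N)%N ->
  0 <= skernel alpha t n (t n.-1) <= head_coef alpha t n.
Proof.
move=> a01 mt nN; have := head_coef_ge _ _ _ _ a01 mt nN.
have : 0 <= skernel alpha t n (t n.-1) by exact: powR_ge0.
by case/andP: a01 => a0 _ g0 h; apply/andP; split; nra.
Qed.

Lemma sub_nonneg_le {R : realType} (X p q : R) : X = p - q -> 0 <= X -> q - 0 <= p - 0.
Proof. lra. Qed.

Lemma sub_swap {R : realType} (X Y p q x y : R) :
  X = p - q -> Y = x - y -> Y <= X -> q - y <= p - x.
Proof. lra. Qed.

Lemma scaled_form_ge0 {R : realType} (alpha : R) (t : nat -> R) (N : nat) :
  0 < alpha < 1 -> mesh t N -> forall n (w : nat -> R), (n <= N)%N ->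
  0 <= \sum_(1 <= k < n.+1) w k * (\sum_(1 <= j < k.+1) scaled_coef alpha t k j * w j).
Proof.
move=> a01 mt; have [a0 a1] := andP a01.
apply: kernel_form_ge0 => n j jn nN.
(* Nonnegativity of a(n, j): the diagonal j = n first, then j < n, each with j = 1 apart because its
   predecessor is the zero boundary value. *)
- have n0 : (0 < n <= N)%N by lia.
  have n0F : (n == 0%N) = false by lia.
  have j0F : (j == 0%N) = false by lia.
  have j1F : (j.-1 == n) = false by lia.
  have [jE|kn] := eqVneq j n.
    have /andP[g0 ga] := head_coef_ge_kernel _ _ _ _ a01 mt n0.
    rewrite jE in j1F; rewrite jE /doubled eqxx n0F j1F {2}/scaled_coef eqxx.
    have [n1|n1] := eqVneq n 1%N.
      rewrite n1 /= in g0 ga; rewrite n1 /=.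
      by rewrite mulr_ge0// /back_moment/= addr0 (le_trans g0).
    have n1F : (n.-1 == 0%N) = false by lia.
    rewrite n1F /scaled_coef j1F.
    apply: (diag_coef_ge _ _ _ _ _ mt _ _ ga); first lia.
    by apply: skernel_convex a01 mt _ _; lia.
  have cj : convex_kernel (t j) (skernel alpha t n).
    by apply: skernel_convex a01 mt _ _; lia.
  rewrite /doubled (negbTE kn) j0F j1F /scaled_coef (negbTE kn) j1F.
  have [j1|j1] := eqVneq j 1%N.
    rewrite j1 /= in cj; rewrite j1 /=; apply: quad_coef1_ge0 mt _ cj; lia.
  have j2F : (j.-1 == 0%N) = false by lia.
  by rewrite j2F; apply: quad_coef_ndecr mt _ cj; lia.
(* Monotonicity in n: for j < n both rows apply the same functional, so linearity reduces the claim
   to the kernel difference. *)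
- have n0 : (0 < n <= N)%N by lia.
  have n1 : (0 < n.+1 <= N)%N by lia.
  have nN' : (0 < n < N)%N by lia.
  have j0F : (j == 0%N) = false by lia.
  have j1F : (j.-1 == n) = false by lia.
  have j2F : (j == n.+1) = false by lia.
  have j3F : (j.-1 == n.+1) = false by lia.
  have jN : (0 < j <= N)%N by lia.
  have jN0 : (j < N)%N by lia.
  have jn1 : (j < n.+1)%N by lia.
  have jn2 : (j.-1 < n)%N by lia.
  have jj : (j.-1 <= j <= N)%N by lia.
  rewrite /doubled j0F j1F j2F j3F /scaled_coef eqxx j1F j2F j3F.
  have cj' := skernel_convex _ _ _ _ _ a01 mt n1 jn1.
  have H := head_coef_ge _ _ _ _ a01 mt n0.
  have H' := skernel_next_le _ _ _ _ a01 mt nN'.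
  have cj1 := skernel_convex _ _ _ _ _ a01 mt n0 jn2.
  have cd1 := skernelB_convex _ _ _ _ _ a01 mt nN' jn2.
  have [j1|j1] := eqVneq j 1%N.
    have [jE|jn'] := eqVneq j n.
      rewrite -jE j1 /= in H H' cj' nN; rewrite -jE j1 /=.
      rewrite !subr0 /back_moment eqxx addr0.
      apply: (diag_coef_step1 _ _ _ _ _ _ mt _ (ltW a0) _ cj' H H');
        [by rewrite -j1|exact: powR_ge0].
    have jn3 : (j < n)%N by lia.
    have cj := skernel_convex _ _ _ _ _ a01 mt n0 jn3.
    have cd := skernelB_convex _ _ _ _ _ a01 mt nN' jn3.
    have BE := quad_coefB _ _ _ _ _ mt jN cj cj'.
    subst j.
    exact: (sub_nonneg_le _ _ _ BE (quad_coef1_ge0 _ _ _ mt jN0 cd)).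
  have j4F : (j.-1 == 0%N) = false by lia.
  have jN2 : (2 <= j < N)%N by lia.
  have jN1 : (0 < j.-1 <= N)%N by lia.
  (* The index j = n is diagonal in row n but not in row n + 1, so the doubled head coefficient is
     compared with an ordinary one. *)
  rewrite j4F; have [jE|jn'] := eqVneq j n.
    rewrite -jE /= in H H' cj' cj1 cd1; rewrite -jE /=.
    exact: (diag_coef_step _ _ _ _ _ _ _ mt jN2 (ltW a0) cj1 cj' cd1 H H').
  have jn3 : (j < n)%N by lia.
  have cj := skernel_convex _ _ _ _ _ a01 mt n0 jn3.
  have cd := skernelB_convex _ _ _ _ _ a01 mt nN' jn3.
  have BE := quad_coefB _ _ _ _ _ mt jN cj cj'.
  have jt : t j.-1 <= t j := mesh_le _ _ _ _ mt jj.
  have BE1 := quad_coefB _ _ _ _ _ mt jN1 cj1 (convex_kernelW _ _ _ jt cj').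
  exact: (sub_swap _ _ _ _ _ _ BE BE1 (quad_coef_ndecr _ _ _ _ mt jN2 cd)).
Qed.

Lemma Gamma_ge0 {R : realType} (x : R) : 0 <= Gamma x.
Proof. by apply: Rintegral_ge0 => u _; rewrite mulr_ge0 ?powR_ge0 ?expR_ge0. Qed.

Lemma omegaE {R : realType} (alpha z : R) :
  omega (1 - alpha) z = z `^ (- alpha) * (Gamma (1 - alpha))^-1.
Proof. by rewrite /omega (_ : 1 - alpha - 1 = - alpha)//; ring. Qed.

Lemma acoef_interior {R : realType} (alpha : R) (t : nat -> R) (N k n : nat) :
  0 < alpha < 1 -> mesh t N -> (0 < k < n)%N -> (n <= N)%N ->
  acoef alpha t n k = (Gamma (1 - alpha))^-1 * mavg t (skernel alpha t n) k.
Proof.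
move=> a01 mt kn nN.
have ck : convex_kernel (t k) (skernel alpha t n).
  by apply: skernel_convex a01 mt _ _; lia.
rewrite /acoef min_l; last by apply/ltW; apply: tshift_gt a01 mt _ _; lia.
under eq_Rintegral do rewrite omegaE.
rewrite RintegralZr//; last first.
  by apply: continuous_on_integrable; apply: convex_kernel_continuous_on ck _.
by rewrite /mavg /avg /step; ring.
Qed.

Lemma acoef_head {R : realType} (alpha : R) (t : nat -> R) (N n : nat) :
  0 < alpha < 1 -> mesh t N -> (0 < n <= N)%N ->
  acoef alpha t n n = (Gamma (1 - alpha))^-1 * head_coef alpha t n.
Proof.
move=> a01 mt nN.
have nn : (n.-1 < n)%N by lia.
have tn := tshift_gt _ _ _ _ _ a01 mt nN nn.
rewrite /acoef min_r; last by apply/ltW; apply: tshift_lt a01 mt nN.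
under eq_Rintegral do rewrite omegaE.
have I := integral_powR_singular alpha _ _ a01 tn.
(* Integrability of the unbounded integrand follows from the finite value [I] of the integral of its
   norm. *)
rewrite RintegralZr//; last first.
  apply/integrableP; split.
    apply/measurable_EFinP; apply: (measurableT_comp (measurable_powR (- alpha))).
    exact: measurable_funB.
  under eq_integral do rewrite /= ger0_norm ?powR_ge0//.
  by rewrite I ltry.
by rewrite /Rintegral /skernel I /head_coef /=; ring.
Qed.

Lemma bcoefE {R : realType} (alpha : R) (t : nat -> R) (N k n : nat) :
  0 < alpha < 1 -> mesh t N -> (0 < k < n)%N -> (n <= N)%N ->
  bcoef alpha t n k =
  (Gamma (1 - alpha))^-1 * (2 / (1 + step_ratio t k.+1) * mmom t (skernel alpha t n) k).
Proof.
move=> a01 mt kn nN.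
have ck : convex_kernel (t k) (skernel alpha t n).
  by apply: skernel_convex a01 mt _ _; lia.
have s : 0 < step t k by rewrite subr_gt0; apply: mesh_step mt _; lia.
have s' : 0 < step t k.+1 by rewrite subr_gt0; apply: mesh_step mt _; lia.
rewrite /bcoef /thalf (addrC (t k)); under eq_Rintegral do rewrite omegaE mulrA.
rewrite RintegralZr//; last first.
  apply: continuous_on_integrable; apply: continuous_on_mid.
  by apply: convex_kernel_continuous_on ck _.
rewrite /mmom /mom -/(step t k) /step_ratio/=.
have : Gamma (1 - alpha) = (Gamma (1 - alpha))^-1^-1 by rewrite invrK.
(* With the inverse as an atom, [field] asks for no nonvanishing of Gamma. *)
move: (Gamma (1 - alpha))^-1 => G _.
by field; apply/andP; split; apply: lt0r_neq0 => //; exact: addr_gt0.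
Qed.

Lemma BcoefE {R : realType} (alpha : R) (t : nat -> R) (N k n : nat) :
  0 < alpha < 1 -> mesh t N -> (0 < k <= n)%N -> (n <= N)%N ->
  Bcoef alpha t n k = (Gamma (1 - alpha))^-1 * scaled_coef alpha t n k.
Proof.
move=> a01 mt kn nN; rewrite /Bcoef /scaled_coef.
have back j : (1 < j <= n)%N -> bcoef alpha t n j.-1 / step_ratio t j =
    (Gamma (1 - alpha))^-1 * back_moment t (skernel alpha t n) j.
  move=> jn; rewrite /back_moment (ifF _ _ (_ : (j == 1%N) = false)); last lia.
  rewrite (bcoefE _ _ _ _ _ a01 mt) ?prednK//; try lia.
  have r : 4 / 7 <= step_ratio t j by apply: mesh_ratio mt _; lia.
  move: (Gamma (1 - alpha))^-1 => G.
  by field; rewrite ?gt_eqF//; lra.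
have [n1|n1] := eqVneq n 1%N.
  have -> : k = n by lia.
  rewrite eqxx n1 /back_moment eqxx addr0.
  by rewrite (acoef_head _ _ _ _ a01 mt)//; lia.
have [kE|kn'] := eqVneq k n.
  rewrite (acoef_head _ _ _ _ a01 mt) ?back ?mulrDr//; lia.
have kn1 : (0 < k < n)%N by lia.
have AE := acoef_interior _ _ _ _ _ a01 mt kn1 nN.
have BE := bcoefE _ _ _ _ _ a01 mt kn1 nN.
have [k1|k1] := eqVneq k 1%N.
  by subst k; rewrite AE BE /quad_coef /back_moment eqxx; ring.
by rewrite AE BE back /quad_coef; [ring|lia].
Qed.

Lemma Bcoef_form_ge0 {R : realType} (alpha : R) (t : nat -> R) (N : nat) :
  0 < alpha < 1 -> mesh t N -> forall n (w : nat -> R), (n <= N)%N ->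
  0 <= \sum_(1 <= k < n.+1) w k * (\sum_(1 <= j < k.+1) Bcoef alpha t k j * w j).
Proof.
move=> a01 mt n w nN.
have -> : \sum_(1 <= k < n.+1) w k * (\sum_(1 <= j < k.+1) Bcoef alpha t k j * w j) =
  (Gamma (1 - alpha))^-1 *
  (\sum_(1 <= k < n.+1) w k * (\sum_(1 <= j < k.+1) scaled_coef alpha t k j * w j)).
  rewrite mulr_sumr; apply: eq_big_nat => k kn.
  rewrite mulrCA; congr (_ * _); rewrite mulr_sumr; apply: eq_big_nat => j jk.
  by rewrite (BcoefE _ _ _ _ _ a01 mt) ?mulrA//; lia.
by rewrite mulr_ge0 ?invr_ge0 ?Gamma_ge0//; apply: scaled_form_ge0 a01 mt _ _ _.
Qed.

(** * Energy inequality *)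

(** Reindexing by the cyclic successor leaves no boundary terms. *)
Lemma cyclic_summation_by_parts {R : comPzRingType} (M : nat) (u w : 'I_M -> R) :
  \sum_(i < M) (u (ordS i) + u (ord_pred i) - 2 * u i) * w i =
  - \sum_(i < M) (u (ordS i) - u i) * (w (ordS i) - w i).
Proof.
have E1 : \sum_(i < M) u (ordS i) * w (ordS i) = \sum_(i < M) u i * w i.
  by rewrite [RHS](reindex_inj (bij_inj (ordS_bij M))).
have E2 : \sum_(i < M) u i * w (ordS i) = \sum_(i < M) u (ord_pred i) * w i.
  rewrite [RHS](reindex_inj (bij_inj (ordS_bij M))).
  by apply: eq_bigr => i _; rewrite ordSK.
have -> : \sum_(i < M) (u (ordS i) + u (ord_pred i) - 2 * u i) * w i =
    \sum_(i < M) u (ordS i) * w i + \sum_(i < M) u (ord_pred i) * w i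
    + (-2) * \sum_(i < M) u i * w i.
  by rewrite mulr_sumr -!big_split/=; apply: eq_bigr => i _; ring.
have -> : \sum_(i < M) (u (ordS i) - u i) * (w (ordS i) - w i) =
    \sum_(i < M) u (ordS i) * w (ordS i) + (-1) * (\sum_(i < M) u (ordS i) * w i)
    + (-1) * (\sum_(i < M) u i * w (ordS i)) + \sum_(i < M) u i * w i.
  by rewrite !mulr_sumr -!big_split/=; apply: eq_bigr => i _; ring.
by rewrite E1 E2; ring.
Qed.

(** The two sides differ by (1/2 - s)(p - q)^2, so weighting the new value by at least 1/2 makes the
    diffusion term dissipative. *)
Lemma mix_diff_ge {R : realType} (s p q : R) : s <= 1 / 2 ->
  (p ^+ 2 - q ^+ 2) / 2 <= ((1 - s) * p + s * q) * (p - q).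
Proof.
move=> s2; rewrite -subr_ge0.
rewrite (_ : _ - _ = (1 / 2 - s) * (p - q) ^+ 2); last by field.
by rewrite mulr_ge0 ?sqr_ge0// subr_ge0.
Qed.

Lemma grad_sqE {R : realType} (M : nat) (h : R) (v : grid R M) : h != 0 ->
  grad_sq h v = \sum_(i < M) \sum_(j < M)
     ((v (ordS i) j - v i j) ^+ 2 + (v i (ordS j) - v i j) ^+ 2).
Proof.
move=> h0; rewrite /grad_sq mulr_sumr; apply: eq_bigr => i _.
by rewrite mulr_sumr; apply: eq_bigr => j _; field.
Qed.

Lemma lap_mix_le {R : realType} (M : nat) (h s : R) (new old : grid R M) :
  h != 0 -> s <= 1 / 2 ->
  h ^+ 2 * \sum_(i < M) \sum_(j < M) lap h (gmix s new old) i j * (new i j - old i j) <=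
  (grad_sq h old - grad_sq h new) / 2.
Proof.
move=> h0 s2; pose u := gmix s new old; pose w i j := new i j - old i j.
have -> : h ^+ 2 * \sum_(i < M) \sum_(j < M) lap h u i j * (new i j - old i j) =
   \sum_(i < M) \sum_(j < M) (u (ordS i) j + u (ord_pred i) j - 2 * u i j) * w i j +
   \sum_(i < M) \sum_(j < M) (u i (ordS j) + u i (ord_pred j) - 2 * u i j) * w i j.
  rewrite mulr_sumr -big_split/=; apply: eq_bigr => i _.
  rewrite mulr_sumr -big_split/=; apply: eq_bigr => j _.
  by rewrite /lap /w; field.
have -> : \sum_(i < M) \sum_(j < M) (u (ordS i) j + u (ord_pred i) j - 2 * u i j) * w i j =
   - \sum_(i < M) \sum_(j < M) (u (ordS i) j - u i j) * (w (ordS i) j - w i j).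
  (* Differences in the first index need the sum over [i] innermost. *)
  rewrite exchange_big [in RHS]exchange_big -sumrN; apply: eq_bigr => j _.
  exact: (cyclic_summation_by_parts M (fun i => u i j) (fun i => w i j)).
have -> : \sum_(i < M) \sum_(j < M) (u i (ordS j) + u i (ord_pred j) - 2 * u i j) * w i j =
   - \sum_(i < M) \sum_(j < M) (u i (ordS j) - u i j) * (w i (ordS j) - w i j).
  by rewrite -sumrN; apply: eq_bigr => i _; exact: cyclic_summation_by_parts.
rewrite -opprD -[leRHS]opprK lerN2 -mulNr opprB.
rewrite !grad_sqE// -sumrB mulr_suml -big_split/=; apply: ler_sum => i _.
rewrite -sumrB mulr_suml -big_split/=; apply: ler_sum => j _.
have := mix_diff_ge s (new (ordS i) j - new i j) (old (ordS i) j - old i j) s2.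
have := mix_diff_ge s (new i (ordS j) - new i j) (old i (ordS j) - old i j) s2.
by rewrite /u /w /gmix; lra.
Qed.

(** Testing the phase equation with the increment makes the nonlinear and stabilization terms equal
    to -(Rn - Ro) by the equation for the auxiliary variable, whatever [Vn] and [f] are. Only the
    Laplacian is left to estimate. *)
Lemma energy_step {R : realType} (M : nat) (h eps m s kappa Vn : R)
    (new old hat : grid R M) (D : grid R M) (f : R -> R) (Rn Ro tau : R) :
  h != 0 -> s <= 1 / 2 -> 0 < m -> 0 < tau ->
  (forall i j, D i j = m * (eps ^+ 2 * lap h (gmix s new old) i j + Vn * f (hat i j)
            - kappa * Vn * (gmix s new old i j - hat i j))) ->
  (Rn - Ro) / tau = Vn * inner h
     (fun i j => - f (hat i j) + kappa * (gmix s new old i j - hat i j))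
     (fun i j => (new i j - old i j) / tau) ->
  energy h eps new Rn + h ^+ 2 / m * \sum_(i < M) \sum_(j < M) (new i j - old i j) * D i j
    <= energy h eps old Ro.
Proof.
move=> h0 s2 m0 tau0 HD HR.
have HR' : Rn - Ro = h ^+ 2 * \sum_(i < M) \sum_(j < M)
    Vn * (- f (hat i j) + kappa * (gmix s new old i j - hat i j)) * (new i j - old i j).
  have t0 := lt0r_neq0 tau0.
  rewrite -[LHS](divfK t0) HR /inner mulrCA -mulrA; congr (_ * _).
  rewrite mulr_sumr mulr_suml; apply: eq_bigr => i _.
  by rewrite mulr_sumr mulr_suml; apply: eq_bigr => j _; field.
have HL := lap_mix_le M h s new old h0 s2.
have E : h ^+ 2 / m * \sum_(i < M) \sum_(j < M) (new i j - old i j) * D i j =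
    eps ^+ 2 * (h ^+ 2 * \sum_(i < M) \sum_(j < M)
      lap h (gmix s new old) i j * (new i j - old i j)) - (Rn - Ro).
  rewrite HR' mulrCA -mulrBr -mulrA; congr (_ * _).
  rewrite !mulr_sumr -sumrB; apply: eq_bigr => i _.
  rewrite !mulr_sumr -sumrB; apply: eq_bigr => j _.
  by rewrite HD; field; exact: lt0r_neq0.
rewrite E /energy; have := ler_wpM2l (sqr_ge0 eps) HL.
by lra.
Qed.

Theorem mainTheorem9 (R : realType) (L m eps alpha beta kappa K1 K2 : R)
  (M N : nat) (F f V : R -> R) (t : nat -> R)
  (phi phihat : nat -> grid R M) (Rs : nat -> R) :
  (* setting *)
  0 < L -> (0 < M)%N -> 0 < m -> 0 < eps -> 0 < alpha < 1 -> 0 <= kappa ->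
  admissible_potential F f beta ->
  V_assumptions V K1 K2 ->
  t 0%N = 0 -> (forall k, (k < N)%N -> t k < t k.+1) ->
  let h := L / M%:R in
  let s := alpha / 2 in
  (* hypotheses of the theorem *)
  (forall k, (2 <= k <= N)%N -> 4 / 7 <= step_ratio t k) ->
  (forall x, - beta <= x <= beta -> `|derive1 f x| <= kappa) ->
  supnorm (phi 0%N) <= beta ->
  step t 1 <= Num.min
    ((4 / (11 * s * m * (kappa + 4 * eps ^+ 2 / h ^+ 2) * Gamma (2 - alpha))) `^ (1 / alpha))
    ((4 / (11 * kappa * (1 - s) * m * Gamma (2 - alpha))) `^ (1 / alpha)) ->
  (* the balanced L2-1_sigma-sESAV scheme *)
  let hatmid n := gmix s (phihat n) (phi n.-1) in
  let mid n := gmix s (phi n) (phi n.-1) in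
  let Vn n := V (gh h F (hatmid n) (Rs n.-1)) in
  supnorm (phihat 1%N) <= beta ->
  (forall i j, Bcoef alpha t 1 1 * (phihat 1%N i j - phi 0%N i j)
               = m * (eps ^+ 2 * lap h (hatmid 1%N) i j + f (hatmid 1%N i j))) ->
  (forall n, (2 <= n <= N)%N -> forall i j,
     phihat n i j = clamp beta ((1 + step_ratio t n) * phi n.-1 i j - step_ratio t n * phi n.-2 i j)) ->
  (forall n, (1 <= n <= N)%N -> forall i j,
     Dfrac alpha t phi n i j
     = m * (eps ^+ 2 * lap h (mid n) i j + Vn n * f (hatmid n i j)
            - kappa * Vn n * (mid n i j - hatmid n i j))) ->
  (forall n, (1 <= n <= N)%N ->
     (Rs n - Rs n.-1) / step t n
     = Vn n * inner h (fun i j => - f (hatmid n i j) + kappa * (mid n i j - hatmid n i j))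
                      (fun i j => (phi n i j - phi n.-1 i j) / step t n)) ->
  (* conclusion: energy stability *)
  forall n, (1 <= n <= N)%N ->
    energy h eps (phi n) (Rs n) <= energy h eps (phi 0%N) (Rs 0%N).
Proof.
move=> L0 M0 m0 _ a01 _ _ _ _ mt h s rt _ _ _ hatmid mid Vn _ _ _ HD HR n /andP[_ nN].
have mesh_t : mesh t N by split.
have h0 : h != 0 by apply: mulf_neq0; rewrite ?invr_eq0 ?pnatr_eq0 -?lt0n// lt0r_neq0.
have s2 : s <= 1 / 2 by rewrite /s; case/andP: a01 => _ a1; lra.
(* The accumulated dissipation, with the time sum innermost so that positivity of the quadratic form
   applies at each grid point. *)
pose W n := \sum_(i < M) \sum_(j < M) \sum_(1 <= k < n.+1)
  (phi k i j - phi k.-1 i j) * Dfrac alpha t phi k i j.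
(* A single row of the form may have either sign, so the dissipation is summed over all levels
   before it is dropped. *)
suff : energy h eps (phi n) (Rs n) + h ^+ 2 / m * W n <= energy h eps (phi 0%N) (Rs 0%N).
  apply: le_trans; rewrite lerDl mulr_ge0//; first by rewrite divr_ge0 ?sqr_ge0// ltW.
  apply: sumr_ge0 => i _; apply: sumr_ge0 => j _.
  exact: (Bcoef_form_ge0 alpha t N a01 mesh_t n (fun k => phi k i j - phi k.-1 i j) nN).
elim: n nN => [|n IH] nN.
  rewrite /W big1 ?mulr0 ?addr0// => i _; rewrite big1// => j _.
  by rewrite big_geq.
apply: le_trans (IH (ltnW nN)).
have -> : W n.+1 = W n + \sum_(i < M) \sum_(j < M)
    (phi n.+1 i j - phi n i j) * Dfrac alpha t phi n.+1 i j.
  rewrite /W -big_split/=; apply: eq_bigr => i _.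
  by rewrite -big_split/=; apply: eq_bigr => j _; rewrite big_nat_recr.
have n1 : (1 <= n.+1 <= N)%N by [].
have tau0 : 0 < step t n.+1 by rewrite subr_gt0; exact: mt.
rewrite mulrDr addrCA [leRHS]addrC lerD2l.
exact: (energy_step M h eps m s kappa (Vn n.+1) (phi n.+1) (phi n) (hatmid n.+1)
  (Dfrac alpha t phi n.+1) f (Rs n.+1) (Rs n) (step t n.+1) h0 s2 m0 tau0
  (HD _ n1) (HR _ n1)).
Qed.
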